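(* Let $a$ be a positive integer, let $\varepsilon > 0$, and let $R = \mathbb{Z}/a\mathbb{Z}$. For each positive integer $n$, let $C_n$ be a deterministic $n\times n$ alternating matrix with entries in $R$, and let $X_n$ be a random $C_n$-symmetric $n \times n$ matrix over $R$ with entries on and above the diagonal independent and $\varepsilon$-balanced. Then the following are equivalent: (1) For any finite abelian group $G$ of exponent dividing $a$, $$\lim_{n\to\infty} \mathbb{E}[\#\operatorname{Sur}(\operatorname{coker}(X_n), G)] = |\wedge^2 G|.$$ (2) $C_n = 0$ for all $n$ large enough.
   Context: An $n\times n$ matrix $C$ over a commutative ring $R$ is alternating if $C^{\intercal} = -C$ and all its diagonal entries are $0$. For an alternating $C$, an $n\times n$ matrix $X$ over $R$ is called $C$-symmetric if $X - X^{\intercal} = C$. A random variable $N$ valued in a ring $R$ is $\varepsilon$-balanced if for every maximal ideal $\mathfrak{p}$ of $R$ and every residue class $r \in R/\mathfrak{p}$ one has $\mathbb{P}[N \equiv r \pmod{\mathfrak{p}}] \leq 1-\varepsilon$. For an $n\times n$ matrix $M$ over $R$, $\operatorname{coker}(M) = R^n/M(R^n)$. $\operatorname{Sur}(A,G)$ is the set of surjective group homomorphisms $A\to G$, and $\wedge^2$ is the exterior square over $\mathbb{Z}$. *)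

(* Defs.v *)
From HB Require Import structures.
From mathcomp Require Import all_boot all_order all_algebra all_fingroup all_solvable.
From mathcomp Require Import finmap.
From mathcomp Require Import all_classical all_reals all_analysis.

Set Implicit Arguments.
Unset Strict Implicit.
Unset Printing Implicit Defensive.

Import Order.TTheory GRing.Theory Num.Theory.
Import numFieldNormedType.Exports.

Local Open Scope ring_scope.

(* Z/aZ for a > 0. 'Z_a would not do for a = 1, since 'Z_1 is Z/2, whereas
   Zmod 1 is the zero ring, and Zmod a.+2 is convertible to 'Z_a.+2. *)
Definition Zmod (a : nat) : Type := 'I_a.-1.+1.

HB.instance Definition _ (a : nat) := Finite.on (Zmod a).
HB.instance Definition _ (a : nat) := GRing.Zmodule.on (Zmod a).
HB.instance Definition _ (a : nat) :=
  GRing.Zmodule_isComPzRing.Build (Zmod a)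
    (@Zp_mulA _) (@Zp_mulC _) (@Zp_mul1z _) (@Zp_mul_addl _).

Definition alternating_mx (R : comPzRingType) (n : nat) (C : 'M[R]_n) : Prop :=
  C^T = - C /\ forall i, C i i = 0.

Definition symmetric_for (R : comPzRingType) (n : nat) (C X : 'M[R]_n) : Prop :=
  X - X^T = C.

Section Cokernel.
Variables (R : finComPzRingType) (n : nat).

Definition mulmx_image (M : 'M[R]_n) : {set 'cV[R]_n} :=
  finset.imset (fun v => M *m v) (mem predT).

Lemma mulmx_image_group_set (M : 'M[R]_n) : group_set (mulmx_image M).
Proof.
apply/group_setP; split; first by apply/imsetP; exists 0; rewrite ?mulmx0.
move=> _ _ /imsetP[u _ ->] /imsetP[v _ ->].
by apply/imsetP; exists (u + v); rewrite ?mulmxDr.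
Qed.

Canonical mulmx_image_group (M : 'M[R]_n) := Group (mulmx_image_group_set M).

(* The underlying group of R^n / M R^n, with R^n the columns; as R^n is abelian,
   every coset of the image lies in coset_of. *)
Definition coker (M : 'M[R]_n) : finGroupType := coset_of (mulmx_image M).

End Cokernel.

Definition Sur (A G : finGroupType) : {set {ffun A -> G}} :=
  finset.finset (fun f : {ffun A -> G} =>
    morphic finset.setT f && [forall y, exists x, f x == y]).

Local Open Scope classical_set_scope.

Section ExteriorSquare.

Definition is_subgroup (V : zmodType) (K : set V) : Prop :=
  K 0 /\ forall u v, K u -> K v -> K (u - v).

Definition gen_subgroup (V : zmodType) (S : set V) : {pred V} :=
  fun v => `[< smallest (@is_subgroup V) S v >].

Lemma gen_subgroup_zmod_closed (V : zmodType) (S : set V) :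
  zmod_closed (gen_subgroup S).
Proof.
split=> [|u v /asboolP Ku /asboolP Kv]; apply/asboolP => K [Kgrp SK].
  by case: Kgrp.
by case: (Kgrp) => _; apply; [apply: Ku | apply: Kv]; split.
Qed.

HB.instance Definition _ (V : zmodType) (S : set V) :=
  GRing.isZmodClosed.Build V (gen_subgroup S) (gen_subgroup_zmod_closed S).

Variable G : finZmodType.

Let free : zmodType := {ffun G * G -> int}.

Definition wedge_gen (x y : G) : free := [ffun z => (z == (x, y))%:R].

Definition wedge_relations : set free :=
  [set v | exists x y z,
     v = wedge_gen (x + y) z - wedge_gen x z - wedge_gen y z] `|`
  [set v | exists x y z,
     v = wedge_gen x (y + z) - wedge_gen x y - wedge_gen x z] `|`
  [set v | exists x, v = wedge_gen x x].

(* The exterior square of G over Z: the free abelian group on G * G (generators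
   wedge_gen x y, to be read as x /\ y) modulo bilinearity and x /\ x = 0. *)
Definition wedge2 : Type := Quotient.quot (gen_subgroup wedge_relations).

HB.instance Definition _ := Choice.on wedge2.
HB.instance Definition _ := GRing.Zmodule.on wedge2.
HB.instance Definition _ := EqQuotient.on wedge2.

Local Notation K := (gen_subgroup wedge_relations).

Let relK v : wedge_relations v -> v \in K.
Proof. by move=> Sv; apply/asboolP => L [_]; exact. Qed.

Let pure0K y : wedge_gen 0 y \in K.
Proof.
rewrite -rpredN; suff -> : - wedge_gen 0 y =
    wedge_gen (0 + 0) y - wedge_gen 0 y - wedge_gen 0 y.
  by apply: relK; left; left; exists 0, 0, y.
by rewrite addr0 subrr sub0r.
Qed.

Let pureMnK x y n : wedge_gen (x *+ n) y - wedge_gen x y *+ n \in K.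
Proof.
elim: n => [|n IHn]; first by rewrite !mulr0n subr0 pure0K.
have -> : wedge_gen (x *+ n.+1) y - wedge_gen x y *+ n.+1 =
    (wedge_gen (x + x *+ n) y - wedge_gen x y - wedge_gen (x *+ n) y) +
    (wedge_gen (x *+ n) y - wedge_gen x y *+ n).
  by rewrite addrA subrK !mulrS opprD addrA.
by apply: rpredD => //; apply: relK; left; left; exists x, (x *+ n), y.
Qed.

Let pure_cardK x y : wedge_gen x y *+ #|G| \in K.
Proof.
rewrite -rpredN -[- _](addKr (wedge_gen (x *+ #|G|) y)) addrC.
apply: rpredB; first exact: pureMnK.
suff -> : x *+ #|G| = 0 by exact: pure0K.
have := @expg_cardG _ [set: G]%G x (finset.in_setT x).
by rewrite cardsT.
Qed.

(* So #|` fset_set [set: wedge2]| is the cardinality of wedge2, not the default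
   value that fset_set gives on infinite sets. *)
Lemma wedge2_finite : finite_set [set: wedge2].
Proof.
pose m := #|G|; have m_gt0 : (0 < m)%N by apply/card_gt0P; exists 0.
pose F (f : {ffun G * G -> 'I_m}) : wedge2 :=
  (\pi_wedge2 ([ffun z => (f z : nat)%:Z] : free))%qT.
apply: (sub_finite_set _ (finite_image F (@finite_finset _ setT))).
move=> q _; set v : free := generic_quotient.repr q.
have lt_m z : (`|(v z %% m)%Z| < m)%N.
  by rewrite -ltz_nat gez0_abs ?modz_ge0 ?ltz_pmod // -lt0n.
exists [ffun z => Ordinal (lt_m z)] => //.
rewrite -[q]generic_quotient.reprK; apply/eqP; rewrite /F -Quotient.idealrBE -rpredN opprB.
set r := (X in v - X).
have pureE z w (k : int) : (wedge_gen z.1 z.2 *+ m *~ k) w = (w == z)%:R * m%:Z * k.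
  have nE n : (wedge_gen z.1 z.2 *+ n) w = ((w == z) * n)%:R.
    by rewrite ffunMnE ffunE -surjective_pairing mulrnA.
  case: k => k; rewrite ?NegzE ?mulrNz -!pmulrn -!mulrnA ?ffunE nE.
    by rewrite !natrM !natz mulrA.
  by rewrite !natrM !natz mulrN mulrA.
have -> : v - r = \sum_(z : G * G) wedge_gen z.1 z.2 *+ m *~ (v z %/ m)%Z.
  apply/ffunP => w; rewrite sum_ffunE !ffunE (bigD1 w) //= big1 => [|z zw].
    rewrite addr0 gez0_abs ?modz_ge0 ?lt0n_neq0 // pureE eqxx mul1r.
    by rewrite {1}(divz_eq (v w) m) addrK mulrC.
  by rewrite pureE eq_sym (negPf zw) !mul0r.
apply: rpred_sum => z _; apply: rpredMz; exact: pure_cardK.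
Qed.

End ExteriorSquare.

Section MaximalIdeal.
Variable R : comPzRingType.

Definition is_ideal (I : set R) : Prop :=
  [/\ I 0, forall x y, I x -> I y -> I (x + y) & forall r x, I x -> I (r * x)].

Definition maximal_ideal (I : set R) : Prop :=
  [/\ is_ideal I, I <> setT &
      forall J : set R, is_ideal J -> I `<=` J -> J = I \/ J = setT].

End MaximalIdeal.

Section Probability.
Context d (T : measurableType d) (R : realType) (P : probability T R).

(* Random element of a finite set, with its discrete sigma-algebra. *)
Definition random_element (A : finType) (N : T -> A) : Prop :=
  forall x : A, measurable (N @^-1` [set x]).

Definition mutually_independent (I A : finType) (N : I -> T -> A) : Prop :=
  forall (J : {set I}) (B : I -> set A),
    P (\bigcap_(i in [set` J]) (N i @^-1` B i)) =
    (\prod_(i in J) P (N i @^-1` B i))%E.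

Definition eps_balanced (A : comPzRingType) (eps : R) (N : T -> A) : Prop :=
  forall p : set A, maximal_ideal p ->
  forall r : A, (P [set w | p (N w - r)%R] <= (1 - eps)%:E)%E.

Definition upper_index (n : nat) : Type := {ij : 'I_n * 'I_n | (ij.1 <= ij.2)%N}.
HB.instance Definition _ n := Finite.on (upper_index n).

Definition upper_entry (A : Type) (n : nat) (X : T -> 'M[A]_n)
    (ij : upper_index n) (w : T) : A := X w (val ij).1 (val ij).2.

Definition random_balanced_symmetric_for (A : finComPzRingType) (n : nat)
    (eps : R) (C : 'M[A]_n) (X : T -> 'M[A]_n) : Prop :=
  [/\ random_element X,
      forall w, symmetric_for C (X w),
      mutually_independent (upper_entry X) &
      forall ij, eps_balanced eps (upper_entry X ij)].

End Probability.

(* Main.v *)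
Require Import Defs.
From HB Require Import structures.
From mathcomp Require Import all_boot all_order all_algebra all_fingroup all_solvable.
From mathcomp Require Import all_field all_character.
From mathcomp Require Import finmap.
From mathcomp Require Import all_classical all_reals all_analysis.
From mathcomp Require Import measurable_realfun complex ring lra.

(** Write A for Z/aZ, e for the character x |-> z^x of A given by a primitive
    a-th root of unity z, and let G be a finite abelian group killed by a.

    A surjection from coker(X) to G is a generating tuple F in G^n with F X = 0
    (card_Sur).  Fourier inversion writes the indicator of F X = 0 as |G|^-n
    times the sum over psi in (dual G)^n of e(sum_i psi_i((F X)_i)).  Since
    X_ji = X_ij - C_ij, the exponent is a linear form in the independent entries
    X_ij with i <= j, minus a constant depending on C.  Its coefficients are the
    values q(h_i) and b(h_i, h_j) at the tuple h_i = (F_i, psi_i) of the form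
    q(g, chi) = chi(g) on G x dual G and of its polarisation b.  Hence the
    expected number of surjections is |G|^-n times a sum over tuples h of
    e(- twist h) and a product of characteristic functions (moment_fourier).  In
    this product a factor with zero coefficient is 1 and any other has modulus
    at most some theta < 1 depending only on a and epsilon (char_fun_bound).

    Tuples with a nonzero coefficient are negligible, whatever C is
    (nonspecial_sum_cvg): consider the set S of values that h takes on a positive
    proportion of the indices.  If S is not isotropic there are of order n^2
    nonzero coefficients.  If S generates an isotropic subgroup of order less
    than |G|, there are exponentially fewer than |G|^n such tuples.  Otherwise S
    generates a Lagrangian, every index outside it costs of order n nonzero
    coefficients, and so does a nonzero value of q on it (tuple_trichotomy).

    Tuples with all coefficients zero and F generating are the graphs
    h_i = (F_i, B(F_i)) of alternating bilinear forms B on G (sum_special), and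
    there are as many such forms as elements in the exterior square of G
    (card_alternating_forms).  So the moment is asymptotic to the sum over B of
    the average over F of e(- twist (F, B o F)) (moment_estimate).

    If C_n = 0 the twists vanish and this is the order of the exterior square.
    Conversely, for G = A^2, the determinant form and F = (x, y), the twist is
    x^T C_n y, whose average over x and y is the proportion of the y with
    C_n y = 0.  This is at most 1/2 when C_n <> 0, so the moment then stays
    away from the order of the exterior square (main_term_half). *)

Set Implicit Arguments.
Unset Strict Implicit.
Unset Printing Implicit Defensive.
Import Order.TTheory GRing.Theory Num.Theory.
Import numFieldNormedType.Exports.
Local Open Scope ring_scope.

(** * Arithmetic of Z/aZ and its characters *)

HB.instance Definition _ (V W : finZmodType) := GRing.Zmodule.on (V * W)%type.
HB.instance Definition _ (I : finType) (V : finZmodType) :=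
  GRing.Zmodule.on {ffun I -> V}.

Lemma pair_mulrn (V W : zmodType) (x : V * W) k : x *+ k = (x.1 *+ k, x.2 *+ k).
Proof. by elim: k => [|k IHk]; rewrite ?mulr0n // !mulrS IHk. Qed.

Section ZmodArithmetic.
Variable a : nat.
Local Notation A := (Zmod a).

Lemma Zmod_mulrn (x y : A) : x *+ (y : nat) = x * y.
Proof. by apply: val_inj; rewrite (@Zp_mulrn a.-1). Qed.

(** An element killed by [a] can be multiplied by residues mod [a]; this is how
    [Zmod a], whose elements coerce to [nat], acts on a group of exponent
    dividing [a].  The modulus is written [a.-1.+1], which is the cardinality
    of [Zmod a] by definition. *)
Lemma Zmod_val_mulrn (V : zmodType) (v : V) (k : nat) :
  v *+ a.-1.+1 = 0 -> v *+ (inZp k : A) = v *+ k.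
Proof.
move=> v0; rewrite [in RHS](divn_eq k a.-1.+1) mulrnDr mulnC mulrnA v0 mul0rn.
by rewrite add0r.
Qed.

Lemma mulrn_ZmodD (V : zmodType) (v : V) (x y : A) :
  v *+ a.-1.+1 = 0 -> v *+ (x + y)%R = v *+ x + v *+ y.
Proof. by move=> v0; rewrite -mulrnDr -(Zmod_val_mulrn (x + y)). Qed.

Lemma Zmod_exp (x : A) : x *+ a.-1.+1 = 0.
Proof.
by apply: val_inj; rewrite (@Zp_mulrn a.-1) /= modnMl.
Qed.

End ZmodArithmetic.

Lemma closed_field_prim_root (F : closedFieldType) (n : nat) :
  n%:R != 0 :> F -> exists z : F, n.-primitive_root z.
Proof.
move=> n0; have n_gt0 : (0 < n)%N by case: n n0 => //; rewrite eqxx.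
have [rs defp] := closed_field_poly_normal ('X^n - 1 : {poly F}).
have {}defp : 'X^n - 1 = \prod_(z <- rs) ('X - z%:P).
  by rewrite [LHS]defp (monicP _) ?scale1r // monicXnsubC.
have rs1 : all n.-unity_root rs.
  by apply/allP => x; rewrite -root_prod_XsubC -defp.
have urs : uniq rs by rewrite -separable_prod_XsubC -defp separable_Xn_sub_1.
have szrs : (n <= size rs)%N.
  by rewrite -ltnS -(size_prod_XsubC _ id) -defp size_XnsubC.
by have /hasP[z _ pz] := has_prim_root n_gt0 rs1 urs szrs; exists z.
Qed.

Section RootCharacter.
Variables (a : nat) (C : numClosedFieldType) (z : C).
Local Notation A := (Zmod a).
Hypothesis z_prim : (a.-1.+1).-primitive_root z.

(** The additive character x |-> z^x of Z/aZ attached to a primitive root of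
    unity [z]. *)
Definition root_char (x : A) : C := z ^+ (x : nat).
Local Notation e := root_char.

Lemma root_char0 : e 0 = 1. Proof. exact: expr0. Qed.

Lemma root_charD x y : e (x + y) = e x * e y.
Proof. by rewrite /e -exprD -(prim_expr_mod z_prim (x + y)). Qed.

Lemma root_char_eq1 x : (e x == 1) = (x == 0).
Proof.
rewrite /e -(prim_order_dvd z_prim) -val_eqE /=.
by rewrite /dvdn modn_small.
Qed.

Lemma norm_root_char x : `|e x| = 1.
Proof.
rewrite /e normrX; suff -> : `|z| = 1 by rewrite expr1n.
apply/eqP; rewrite -(@pexpr_eq1 _ _ a.-1.+1) // -normrX.
by rewrite prim_expr_order // normr1.
Qed.

Lemma root_charN x : e (- x) = (e x)^*.
Proof.
have e0 : e x != 0 by rewrite -normr_eq0 norm_root_char oner_eq0.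
apply: (mulfI e0); rewrite -root_charD subrr root_char0 -normCK.
by rewrite norm_root_char expr1n.
Qed.

Lemma root_char_sum (I : finType) (P : pred I) (F : I -> A) :
  e (\sum_(i | P i) F i) = \prod_(i | P i) e (F i).
Proof. exact: (big_morph e root_charD root_char0). Qed.

(** Orthogonality: if [f] is nonzero at some x0 in [B], translating the
    summation variable by x0 multiplies the sum by e(f x0), which is not 1. *)
Lemma root_char_sum_subgroup (V : finZmodType) (B : {set V}) (f : V -> A) :
    0 \in B -> {in B &, forall x y, x - y \in B} ->
    {morph f : x y / x + y} ->
  \sum_(x in B) e (f x) = if [forall x in B, f x == 0] then #|B|%:R else 0.
Proof.
move=> B0 Bsub fD; case: ifPn => [/forall_inP f0 | ].
  rewrite (eq_bigr (fun _ => 1)) ?sumr_const // => x /f0 /eqP ->.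
  exact: root_char0.
rewrite negb_forall_in => /exists_inP[x0 Bx0 fx0].
have e1 : e (f x0) - 1 != 0 by rewrite subr_eq0 root_char_eq1.
apply: (mulfI e1); rewrite mulr0 mulrBl mul1r; apply/eqP; rewrite subr_eq0.
apply/eqP; rewrite [RHS](reindex_inj (addIr x0)) /= big_distrr /=.
apply: eq_big => [x|x _]; last by rewrite fD root_charD mulrC.
apply/idP/idP => Bx.
  by rewrite -[x0]opprK -[- x0]sub0r !Bsub.
by rewrite -[x](addrK x0) Bsub.
Qed.

Lemma root_char_sumT (V : finZmodType) (f : V -> A) :
    {morph f : x y / x + y} ->
  \sum_x e (f x) = if [forall x, f x == 0] then #|V|%:R else 0.
Proof.
move=> fD; have := @root_char_sum_subgroup V [set: V] f.
rewrite finset.in_setT cardsT => /(_ isT) sumT.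
rewrite -(eq_bigl _ _ (@finset.in_setT V)) sumT //; last first.
  by move=> *; rewrite finset.in_setT.
congr (if _ then _ else _).
by apply: eq_forallb => x; rewrite finset.in_setT.
Qed.

End RootCharacter.

(** * Duality for finite abelian groups *)

Section Dual.
Variable a : nat.
Local Notation A := (Zmod a).

Section Def.
Variable G : finZmodType.

Definition is_char : {pred {ffun G -> A}} :=
  fun f => [forall x, forall y, f (x + y) == f x + f y].

Lemma is_charP (f : {ffun G -> A}) :
  reflect {morph f : x y / x + y} (f \in is_char).
Proof.
apply: (iffP forallP) => [f_add x y|f_add x]; first by have /forallP/(_ y)/eqP := f_add x.
by apply/forallP => y; rewrite f_add.
Qed.

Lemma is_char_zmod_closed : zmod_closed is_char.
Proof.
split=> [|f g /is_charP fD /is_charP gD]; apply/is_charP => x y.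
  by rewrite !ffunE addr0.
by rewrite !ffunE fD gD opprD addrACA.
Qed.

HB.instance Definition _ :=
  GRing.isZmodClosed.Build {ffun G -> A} is_char is_char_zmod_closed.

(** The group Hom(G, Z/aZ), which is the Pontryagin dual of [G] as soon as the
    exponent of [G] divides [a]; values in Z/aZ, rather than in roots of unity,
    let characters be multiplied by the entries of a matrix. *)
Record dual : Type := Dual { dual_val :> {ffun G -> A}; _ : dual_val \in is_char }.

HB.instance Definition _ := [isSub for dual_val].
HB.instance Definition _ := [Finite of dual by <:].
HB.instance Definition _ := [SubChoice_isSubZmodule of dual by <:].

Lemma dualD (f : dual) : {morph f : x y / x + y}.
Proof. by apply/is_charP; case: f. Qed.

HB.instance Definition _ (f : dual) :=
  GRing.isNmodMorphism.Build G A (f : G -> A)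
    (conj (addrI (f 0) (etrans (esym (dualD f 0 0))
       (etrans (congr1 f (addr0 0)) (esym (addr0 _))))) (dualD f)).

Lemma add_dualE (f g : dual) x : (f + g) x = f x + g x.
Proof. by rewrite [LHS]ffunE. Qed.

Lemma zero_dualE x : (0 : dual) x = 0.
Proof. by rewrite [LHS]ffunE. Qed.

Lemma mulrn_dualE (f : dual) k x : (f *+ k) x = f x *+ k.
Proof.
elim: k => [|k IHk]; first by rewrite !mulr0n zero_dualE.
by rewrite !mulrS add_dualE IHk.
Qed.

Definition mkdual (f : G -> A) (fD : {morph f : x y / x + y}) : dual.
Proof.
refine (@Dual (finfun f) _).
by apply/is_charP => x y; rewrite !ffunE fD.
Defined.

Lemma mkdualE f fD x : @mkdual f fD x = f x.
Proof. by rewrite [LHS]ffunE. Qed.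

Lemma dualP (f g : dual) : (forall x, f x = g x) -> f = g.
Proof. by move=> fg; apply/val_inj/ffunP. Qed.

End Def.

Lemma dual_exp (G : finZmodType) (f : dual G) : f *+ a.-1.+1 = 0.
Proof. by apply: dualP => x; rewrite mulrn_dualE Zmod_exp zero_dualE. Qed.

Section Separation.
Variable G : finZmodType.
Hypothesis G_exp : forall x : G, x *+ a.-1.+1 = 0.

(** Characters of an abelian group over the algebraic numbers are linear and
    have trivial common kernel; their values are a-th roots of unity, whose
    discrete logarithms are the required elements of [dual G]. *)
Lemma dual_separates (x : G) : x != 0 -> exists f : dual G, f x != 0.
Proof.
move=> x0.
have abG : abelian [set: G]%G.
  by apply/fintype.subsetP => u _; apply/centP => v _; exact: addrC.
have [i chi_x] : exists i : Iirr [set: G]%G, 'chi_i x != 1.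
  apply/existsP; apply: contraTT isT; rewrite negb_exists => /forallP chi1.
  have : x \in \bigcap_i cfker 'chi[[set: G]%G]_i.
    apply/bigcapP => i _; rewrite cfkerEirr inE lin_char1; last exact/char_abelianP.
    by have := chi1 i; rewrite negbK.
  by rewrite TI_cfker_irr => /set1P xe; rewrite xe eqxx in x0.
have lin_i : 'chi_i \is a linear_char by apply/char_abelianP.
have [w w_prim] := C_prim_root_exists (ltn0Sn a.-1).
have logP y : exists k : 'I_(a.-1.+1), 'chi_i y == w ^+ k.
  have [|k ->] := @prim_rootP _ _ w w_prim ('chi_i y); last by exists k.
  rewrite -lin_charX ?finset.in_setT // (_ : y ^+ _ = 1)%g ?lin_char1 //.
  exact: G_exp.
pose f y : A := xchoose (logP y).
have fE y : w ^+ (f y) = 'chi_i y by apply/esym/eqP/(xchooseP (logP y)).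
have fD : {morph f : u v / u + v}.
  move=> u v; apply: val_inj; rewrite /= -[LHS](modn_small (ltn_ord _)).
  apply/eqP; rewrite -(eq_prim_root_expr w_prim) exprD !fE.
  by rewrite -lin_charM ?finset.in_setT.
exists (mkdual fD); rewrite mkdualE; apply: contra chi_x => /eqP fx0.
by rewrite -fE fx0.
Qed.

Lemma sum_dual_root_char (C : numClosedFieldType) (z : C) (x : G) :
    (a.-1.+1).-primitive_root z ->
  \sum_(f : dual G) root_char z (f x) = if x == 0 then #|{: dual G}|%:R else 0.
Proof.
move=> z_prim; rewrite (root_char_sumT z_prim (fun f g : dual G => add_dualE f g x)).
congr (if _ then _ else _); apply/forallP/eqP => [f0|-> f]; last by rewrite raddf0.
by apply/eqP; apply: contraT => /dual_separates[f /negP[]]; exact: f0.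
Qed.

(** Sum e(f x) over all [x] and [f] in both orders: by orthogonality one order
    gives the cardinality of [dual G], the other that of [G]. *)
Lemma card_dual : #|{: dual G}| = #|G|.
Proof.
have [z z_prim] := C_prim_root_exists (ltn0Sn a.-1).
apply/eqP; rewrite -(eqr_nat algC); apply/eqP.
have sumf (f : dual G) : \sum_x root_char z (f x) = if f == 0 then #|G|%:R else 0.
  rewrite (root_char_sumT z_prim (dualD f)); congr (if _ then _ else _).
  apply/forallP/eqP => [f0|-> x]; last by rewrite zero_dualE.
  by apply: dualP => x; rewrite zero_dualE; apply/eqP.
transitivity (\sum_(x : G) \sum_(f : dual G) root_char z (f x)).
  rewrite (eq_bigr _ (fun x _ => sum_dual_root_char x z_prim)).
  by rewrite -big_mkcond big_pred1_eq.
by rewrite exchange_big (eq_bigr _ (fun f _ => sumf f)) -big_mkcond big_pred1_eq.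
Qed.

End Separation.

Section Perp.
Variables (H : finZmodType) (b : H -> H -> A).
Hypothesis bC : forall x y, b x y = b y x.
Hypothesis bD : forall x, {morph b x : y y' / y + y'}.
Hypothesis b_nondeg : forall x, (forall y, b x y = 0) -> x = 0.

(** The orthogonal of [S]; [perp (perp S)] serves below as the subgroup
    generated by [S]. *)
Definition perp (S : {set H}) : {set H} := [set y | [forall x in S, b x y == 0]].

Lemma perpP (S : {set H}) y : reflect (forall x, x \in S -> b x y = 0) (y \in perp S).
Proof. by rewrite inE; apply: (iffP forall_inP) => Sy x /Sy /eqP. Qed.

Lemma bilin0 x : b x 0 = 0.
Proof. by apply: (addrI (b x 0)); rewrite -bD !addr0. Qed.

Lemma bilinB x y y' : b x (y - y') = b x y - b x y'.
Proof. by apply/eqP; rewrite eq_sym subr_eq -bD subrK. Qed.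

Lemma perp0 S : 0 \in perp S.
Proof. by apply/perpP => x _; exact: bilin0. Qed.

Lemma perpB S : {in perp S &, forall x y, x - y \in perp S}.
Proof.
by move=> x y /perpP Sx /perpP Sy; apply/perpP => w Sw; rewrite bilinB Sx ?Sy ?subrr.
Qed.

Lemma sub_perp_perp (S : {set H}) : S \subset perp (perp S).
Proof.
by apply/fintype.subsetP => x Sx; apply/perpP => y /perpP Sy; rewrite bC Sy.
Qed.

Lemma perpS (S S' : {set H}) : S \subset S' -> perp S' \subset perp S.
Proof.
move=> /fintype.subsetP SS'; apply/fintype.subsetP => x /perpP S'x.
by apply/perpP => y /SS' /S'x.
Qed.

(** Sum e(b x y) over x in [B] and y in [H].  Summing over y first, only x = 0
    survives by nondegeneracy; summing over x first, only the y orthogonal to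
    [B] survive. *)
Lemma card_perp (B : {set H}) :
    0 \in B -> {in B &, forall x y, x - y \in B} ->
  (#|B| * #|perp B|)%N = #|H|.
Proof.
move=> B0 BB.
have [z z_prim] := C_prim_root_exists (ltn0Sn a.-1).
apply/eqP; rewrite -(eqr_nat algC); apply/eqP.
transitivity (\sum_(x in B) \sum_y root_char z (b x y)).
  rewrite exchange_big /= (bigID (mem (perp B))) /= [X in _ + X]big1 ?addr0.
    under eq_bigr => y By.
      rewrite (eq_bigr (fun=> 1)) ?sumr_const; last first.
        by move=> x Bx; rewrite (perpP _ _ By) // root_char0.
      over.
    by rewrite sumr_const natrM mulr_natr.
  move=> y yB; rewrite (root_char_sum_subgroup z_prim B0 BB) ?ifF //.
    by apply: contraNF yB => By; rewrite inE.
  by move=> x x'; rewrite ![b _ y]bC bD.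
rewrite (bigD1 0) //= [X in _ + X]big1 ?addr0 => [|x /andP[Bx x0]].
  rewrite (root_char_sumT z_prim (bD 0)) ifT //.
  by apply/forallP => y; rewrite bC bilin0.
rewrite (root_char_sumT z_prim (bD x)) ifF //.
by apply: contraNF x0 => /forallP b0; apply/eqP/b_nondeg => y; apply/eqP.
Qed.

End Perp.

End Dual.

(** * Tuples with few nonzero coefficients *)

Lemma big_upper_index (M : Type) (idx : M) (op : Monoid.com_law idx) (n : nat)
    (f : 'I_n -> 'I_n -> M) :
  \big[op/idx]_(ij : upper_index n) f (val ij).1 (val ij).2 =
  \big[op/idx]_(i < n) \big[op/idx]_(j < n | (i <= j)%N) f i j.
Proof.
rewrite pair_big_dep /=.
exact: (esym (big_sub (fun ij : 'I_n * 'I_n => (ij.1 <= ij.2)%N)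
                      (fun ij => f ij.1 ij.2))).
Qed.

Section QuadraticTuples.
Variables (a : nat) (H : finZmodType).
Local Notation A := (Zmod a).
Variables (b : H -> H -> A) (q : H -> A) (g : nat).
Hypothesis bC : forall x y, b x y = b y x.
Hypothesis bD : forall x, {morph b x : y y' / y + y'}.
Hypothesis b_nondeg : forall x, (forall y, b x y = 0) -> x = 0.
Hypothesis qD : forall x y, q (x + y) = q x + q y + b x y.
Hypothesis card_H : #|H| = (g * g)%N.

Let q0 : q 0 = 0.
Proof.
have := qD 0 0; rewrite (bilin0 bD) !addr0 => q00.
by apply: (addrI (q 0)); rewrite -q00 addr0.
Qed.

Let g_gt0 : (0 < g)%N.
Proof.
have : (0 < #|H|)%N by apply/card_gt0P; exists 0.
by rewrite card_H; case: g.
Qed.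

Section Isotropic.
Variable S : {set H}.
Hypothesis S_iso : S \subset perp b S.
Hypothesis S_big : (g <= #|perp b (perp b S)|)%N.

(** An isotropic set whose double orthogonal has at least [g] elements spans a
    Lagrangian: the orders of [perp S] and of its orthogonal multiply to g^2
    and the latter is contained in the former, so that both equal [g]. *)
Lemma lagrangian_card : #|perp b S| = g.
Proof.
have le1 : (#|perp b (perp b S)| <= #|perp b S|)%N by apply/subset_leq_card/perpS.
have := card_perp bC bD b_nondeg (perp0 bD S) (@perpB _ _ _ bD S).
rewrite card_H => eqg; apply/eqP; rewrite eqn_leq (leq_trans S_big le1) andbT.
by rewrite -(leq_pmul2r g_gt0) -eqg leq_mul2l S_big orbT.
Qed.

Lemma lagrangian_perp : perp b (perp b S) = perp b S.
Proof.
by apply/eqP; rewrite eqEcard perpS // lagrangian_card S_big.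
Qed.

(** The zeros of [q] in [perp S] form a subgroup containing [S]; its order is
    at least [g] since its orthogonal lies in [perp S].  So it is all of
    [perp S]. *)
Lemma lagrangian_isotropic :
  {in S, forall x, q x = 0} -> {in perp b S, forall x, q x = 0}.
Proof.
move=> qS; pose L0 := perp b S :&: [set x | q x == 0].
have L0P x : reflect (x \in perp b S /\ q x = 0) (x \in L0).
  by rewrite finset.in_setI [X in _ && X]inE; apply: (iffP andP) => -[Sx /eqP qx].
have perp_iso x y : x \in perp b S -> y \in perp b S -> b x y = 0.
  by move=> Sx; rewrite -[in X in X -> _]lagrangian_perp => /perpP /(_ x Sx).
have S_L0 : S \subset L0.
  apply/fintype.subsetP => x Sx; apply/L0P; split; last exact: qS.
  exact: (fintype.subsetP S_iso).
have := card_perp bC bD b_nondeg (B := L0); rewrite card_H => card_L0.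
have {}card_L0 : (#|L0| * #|perp b L0|)%N = (g * g)%N.
  apply: card_L0; first by apply/L0P; split; [exact: perp0 | exact: q0].
  move=> x y /L0P[Sx qx] /L0P[Sy qy]; apply/L0P; split; first exact: perpB.
  have := qD (x - y) y; rewrite subrK qx qy addr0.
  by rewrite (perp_iso _ _ (perpB bD Sx Sy) Sy) addr0.
have le_g : (#|perp b L0| <= g)%N.
  by rewrite -lagrangian_card; apply/subset_leq_card/perpS.
have ge_g : (g <= #|L0|)%N.
  by rewrite -(leq_pmul2r g_gt0) -card_L0 leq_mul2l le_g orbT.
have L0E : L0 = perp b S.
  apply/eqP; rewrite eqEcard lagrangian_card ge_g andbT.
  by apply/fintype.subsetP => x /L0P[].
by move=> x; rewrite -L0E => /L0P[].
Qed.

End Isotropic.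

Variable n : nat.
Implicit Type h : {ffun 'I_n -> H}.

(** The coefficient of the (i, j) entry of the random matrix in the Fourier
    exponent attached to the tuple [h]. *)
Definition coef h (ij : upper_index n) : A :=
  let: (i, j) := val ij in if i == j then q (h i) else b (h i) (h j).

Definition ncoef h : nat := #|[set ij : upper_index n | coef h ij != 0]|.

Definition noutside (L : {set H}) h : nat := #|[set i | h i \notin L]|.

(** The values that [h] takes on a proportion at least 1/K of the indices. *)
Definition heavy (K : nat) h : {set H} :=
  [set x | (n <= K * #|[set i | h i == x]|)%N].

Lemma ncoefE h :
  ncoef h = (\sum_(i < n) \sum_(j < n | (i <= j)%N)
    ((if i == j then q (h i) else b (h i) (h j)) != 0%R))%N.
Proof.
rewrite -(big_upper_index _ (fun i j : 'I_n =>
  ((if i == j then q (h i) else b (h i) (h j)) != 0) : nat)).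
rewrite /ncoef cardsE -sum1_card big_mkcond.
by apply: eq_bigr => -[[i j] ij] _; rewrite unfold_in /coef /=; case: (_ != 0).
Qed.

Lemma ncoef_diag h x : q x != 0 -> (#|[set i | h i == x]| <= ncoef h)%N.
Proof.
move=> qx; rewrite ncoefE cardsE -sum1_card big_mkcond /=.
apply: leq_sum => i _; rewrite (bigD1 i) //= eqxx.
by case: ifP => // /eqP ->; rewrite qx.
Qed.

(** Each pair i < j with nonzero pairing is counted twice on the left and once
    in [ncoef h]. *)
Lemma ncoef_double h :
  (\sum_i #|[set j | (j != i) && (b (h i) (h j) != 0%R)]| <= 2 * ncoef h)%N.
Proof.
pose B (i j : 'I_n) : nat := b (h i) (h j) != 0.
have lt_le : (\sum_(i < n) \sum_(j < n | i < j) B i j <= ncoef h)%N.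
  rewrite ncoefE; apply: leq_sum => i _.
  rewrite [X in (_ <= X)%N](bigID [pred j : 'I_n | (i < j)%N]) /=.
  apply: leq_trans (leq_addr _ _); apply: eq_leq; apply: eq_big => [j|j ij].
    by case: ltngtP.
  have /negPf -> : i != j by rewrite -val_eqE /= ltn_eqF.
  by [].
rewrite mul2n -addnn; apply: leq_trans (leq_add lt_le lt_le).
rewrite [X in (_ <= _ + X)%N](exchange_big_dep predT) //= -big_split /=.
apply: leq_sum => i _; rewrite -sum1dep_card big_mkcond /=.
rewrite [X in (_ <= X + _)%N]big_mkcond [X in (_ <= _ + X)%N]big_mkcond /=.
rewrite -big_split /=; apply: leq_sum => j _.
rewrite /B [b (h j) (h i)]bC.
have -> : (j == i) = (j == i :> nat) by [].
by case: (ltngtP i j) => //= _; case: (_ != 0).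
Qed.

(** A value not orthogonal to all heavy values pairs nontrivially with some
    heavy y, hence with every index carrying y other than possibly i itself. *)
Lemma heavy_perp K h i : h i \notin perp b (heavy K h) ->
  (n - K <= K * #|[set j | (j != i) && (b (h i) (h j) != 0%R)]|)%N.
Proof.
rewrite inE negb_forall_in => /exists_inP[y]; rewrite inE => heavy_y by0.
rewrite leq_subLR -mulnS; apply: leq_trans heavy_y _; rewrite leq_mul2l.
apply/orP; right; rewrite (cardsD1 i); apply: leq_trans (leq_add (leq_b1 _) _) _.
  by apply: (subset_leq_card (_ : _ \subset
    [set j | (j != i) && (b (h i) (h j) != 0%R)])); apply/fintype.subsetP => j;
    rewrite !inE => /andP[-> /eqP ->]; rewrite bC.
by rewrite add1n.
Qed.

Lemma ncoef_heavy K h :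
  (noutside (perp b (heavy K h)) h * (n - K) <= 2 * K * ncoef h)%N.
Proof.
rewrite [(2 * K)%N]mulnC -mulnA.
apply: leq_trans (leq_mul (leqnn K) (ncoef_double h)).
rewrite big_distrr /= (bigID [pred i | h i \notin perp b (heavy K h)]) /=.
apply: leq_trans (leq_addr _ _); rewrite /noutside cardsE -sum_nat_const.
by apply: leq_sum => i; exact: heavy_perp.
Qed.

Lemma noutside_light K h (L : {set H}) :
  heavy K h \subset L -> (K * noutside L h <= #|H| * n)%N.
Proof.
move=> /fintype.subsetP SL.
have -> : noutside L h = (\sum_(x | x \notin L) #|[set i | h i == x]|)%N.
  rewrite /noutside -sum1dep_card (partition_big h [pred x | x \notin L]) //=.
  apply: eq_bigr => x xL; rewrite -sum1dep_card; apply: eq_bigl => i.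
  by case: eqP => [->|]; rewrite ?andbF // xL.
rewrite big_distrr /=; apply: (@leq_trans (\sum_(x | x \notin L) n)).
  apply: leq_sum => x xL; rewrite ltnW // ltnNge; apply: contra xL => hx.
  by apply: SL; rewrite inE.
by rewrite sum_nat_const leq_mul2r max_card orbT.
Qed.

(** Let S be the set of heavy values.  If S is not isotropic, two heavy values
    pair nontrivially, which gives quadratically many nonzero coefficients.
    If S is isotropic and generates a group L with fewer than [g] elements,
    then almost all values of [h] lie in L, and such tuples are rare.
    Otherwise L is Lagrangian: every index outside L costs a number of nonzero
    coefficients linear in [n], and if there is no such index then [q] is
    nonzero at some heavy value, which costs the same. *)
Lemma tuple_trichotomy K K' h :
    K = (#|H| * K')%N -> (0 < K')%N -> (0 < ncoef h)%N ->
  [\/ (n * (n - K) <= 2 * K * K * ncoef h)%N,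
      exists2 L : {set H}, (#|L| < g)%N & (K' * noutside L h <= n)%N
    | exists2 L : {set H}, (#|L| <= g)%N &
        ((n - K) * (1 + noutside L h) <= 4 * K * ncoef h)%N].
Proof.
move=> KE K'_gt0 h_gt0; set S := heavy K h.
have H_gt0 : (0 < #|H|)%N by apply/card_gt0P; exists 0.
have K_gt0 : (0 < K)%N by rewrite KE muln_gt0 H_gt0.
case: (boolP (S \subset perp b S)) => [S_iso|/subsetPn[x Sx xS]]; last first.
  (* A heavy x outside the orthogonal: its n / K indices are all outside. *)
  apply: Or31.
  have out_x : (n <= K * noutside (perp b S) h)%N.
    move: (Sx); rewrite inE => /leq_trans; apply; rewrite leq_mul2l.
    apply/orP; right; apply/subset_leq_card/fintype.subsetP => i.
    by rewrite !inE => /eqP ->; move: xS; rewrite inE.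
  apply: (@leq_trans (K * noutside (perp b S) h * (n - K))%N).
    by rewrite leq_mul2r out_x orbT.
  rewrite -mulnA [(2 * K * K)%N]mulnC -!mulnA leq_mul2l; apply/orP; right.
  by rewrite mulnA; exact: ncoef_heavy.
case: (ltnP #|perp b (perp b S)| g) => [small|S_big].
  apply: Or32; exists (perp b (perp b S)) => //.
  rewrite -(leq_pmul2l H_gt0) mulnA -KE; apply: noutside_light.
  exact: sub_perp_perp.
apply: Or33; exists (perp b S); first by rewrite lagrangian_card.
have := ncoef_heavy K h; rewrite -/S.
case: (posnP (noutside (perp b S) h)) => [out0 _|out_gt0 out_le]; last first.
  apply: (@leq_trans (2 * (noutside (perp b S) h * (n - K)))%N).
    by rewrite mulnC mulnA leq_mul2r mul2n -addnn leq_add2r out_gt0 orbT.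
  by rewrite (_ : 4 * K * _ = 2 * (2 * K * ncoef h))%N ?leq_mul2l ?out_le ?orbT //
    !mulnA.
(* All values lie in the Lagrangian, so only [q] can make a coefficient nonzero. *)
rewrite out0 muln1.
have hS i : h i \in perp b S.
  apply: contraTT isT => hiS; have /eqP := out0; rewrite cards_eq0 => /eqP out_set0.
  have : i \in [set i | h i \notin perp b S] by rewrite inE.
  by rewrite out_set0 finset.in_set0.
have [x Sx qx] : exists2 x, x \in S & q x != 0.
  apply/exists_inP; apply: contraTT h_gt0; rewrite negb_exists_in => /forall_inP qS.
  have {}qS : {in S, forall x, q x = 0} by move=> x /qS; rewrite negbK => /eqP.
  rewrite -leqNgt leqn0 cards_eq0; apply/eqP/setP => -[[i j] ij]; rewrite !inE /coef /=.
  apply/negbTE; rewrite negbK; case: ifP => _.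
    by rewrite (lagrangian_isotropic S_iso S_big qS).
  have := hS j; rewrite -{1}lagrangian_perp // => /perpP /(_ _ (hS i)) ->.
  by rewrite eqxx.
have nK : (n <= K * ncoef h)%N.
  by move: Sx; rewrite inE => /leq_trans; apply; rewrite leq_mul2l ncoef_diag ?orbT.
apply: leq_trans (leq_subr _ _) (leq_trans nK _).
by rewrite -mulnA leq_pmull.
Qed.

End QuadraticTuples.

(** * Tuples with a nonzero coefficient are negligible *)

Section PowerBounds.
Variable R : realType.
Implicit Types x y t : R.

(** Bernoulli's inequality, applied to 1 - (1 - x) / (D + 1). *)
Lemma exists_root_above x (D : nat) :
  0 <= x -> x < 1 -> exists y, [/\ 0 < y, y < 1 & x <= y ^+ D].
Proof.
move=> x0 x1; pose d := (1 - x) / D.+1%:R.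
have D0 : 0 < D.+1%:R :> R by rewrite ltr0n.
have d0 : 0 < d by rewrite divr_gt0 // subr_gt0.
have d1 : D.+1%:R * d <= 1 by rewrite mulrC divfK ?gt_eqF //; lra.
have dle : d <= D.+1%:R * d by rewrite ler_peMl ?ler1n // ltW.
have Bern k : (k <= D)%N -> 1 - k.+1%:R * d <= (1 - d) ^+ k - d.
  elim: k => [|k IHk] kD; first by rewrite expr0 mul1r.
  have := IHk (ltnW kD); rewrite exprS.
  have : (1 - d) ^+ k <= 1 by rewrite exprn_ile1 //; lra.
  have : 0 <= d * (1 - (1 - d) ^+ k).
    by rewrite mulr_ge0 ?(ltW d0) // subr_ge0 exprn_ile1 //; lra.
  by rewrite -[k.+2%:R]natr1; nra.
have xd : x = 1 - D.+1%:R * d by rewrite mulrC divfK ?gt_eqF //; lra.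
(* For D = 0 the value 1 - d may be 0. *)
have [D0'|D_gt0] := posnP D.
  by exists (1 / 2); rewrite D0' expr0; split; lra.
exists (1 - d); split; [|lra|].
  have : D.+1%:R = 1 + D%:R :> R by rewrite nat1r.
  have : 1 <= D%:R :> R by rewrite ler1n.
  by nra.
by have := Bern D (leqnn D); rewrite -xd; lra.
Qed.

Lemma exists_expr_below x t : 0 <= x -> x < 1 -> 0 < t ->
  exists2 m : nat, (0 < m)%N & x ^+ m <= t.
Proof.
move=> x0 x1 t0.
have x_lt1 : `|x| < 1 by rewrite ger0_norm.
have /cvgrPdist_le /(_ _ t0) [N _ /(_ N.+1 (leqnSn N))] := cvg_expr x_lt1.
rewrite sub0r normrN ger0_norm ?exprn_ge0 // => xN.
by exists N.+1.
Qed.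

Lemma geometric_squeeze (u : nat -> R) (c r : R) (N : nat) :
    0 <= r -> r < 1 -> (forall n, (N <= n)%N -> 0 <= u n <= c * r ^+ n) ->
  (u n @[n --> \oo] --> (0 : R))%classic.
Proof.
move=> r0 r1 ur; have r_lt1 : `|r| < 1 by rewrite ger0_norm.
apply: (@squeeze_cvgr _ _ _ _ (fun=> 0) (fun n => c * r ^+ n)).
- by exists N => // n /= Nn; exact: ur.
- exact: cvg_cst.
- by rewrite -[X in (_ --> X)%classic](mulr0 c); apply: cvgM;
    [exact: cvg_cst | exact: cvg_expr].
Qed.

End PowerBounds.

Section WeightedTuples.
Variables (R : realType) (H : finZmodType) (n : nat).

Lemma expr_noutside_prod (L : {set H}) (h : {ffun 'I_n -> H}) (t : R) :
  t ^+ noutside L h = \prod_i (if h i \in L then 1 else t).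
Proof.
rewrite -prodr_const big_mkcond /=; apply: eq_bigr => i _.
by rewrite inE; case: (h i \in L).
Qed.

Lemma sum_expr_noutside (L : {set H}) (t : R) : 0 <= t ->
  \sum_(h : {ffun 'I_n -> H}) t ^+ noutside L h <= (#|L|%:R + t * #|H|%:R) ^+ n.
Proof.
move=> t0.
under eq_bigr do rewrite expr_noutside_prod.
rewrite -(bigA_distr_bigA (fun (_ : 'I_n) (x : H) => if x \in L then 1 else t : R)).
rewrite prodr_const card_ord lerXn2r // ?nnegrE.
- by apply: sumr_ge0 => x _; case: ifP.
- by rewrite addr_ge0 ?mulr_ge0 ?ler0n.
rewrite (bigID (mem L)) /= lerD //.
  by rewrite (eq_bigr (fun=> 1)) ?sumr_const // => x ->.
rewrite (eq_bigr (fun=> t)) => [|x /negPf -> //].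
rewrite (_ : \sum_(i | i \notin L) t = t *+ #|~: L|); last first.
  by rewrite -sumr_const; apply: eq_bigl => i; rewrite inE.
by rewrite -[t *+ _]mulr_natr ler_wpM2l // ler_nat max_card.
Qed.

End WeightedTuples.

Section NonspecialSum.
Variables (a : nat) (H : finZmodType).
Local Notation A := (Zmod a).
Variables (b : H -> H -> A) (q : H -> A) (g : nat).
Hypothesis bC : forall x y, b x y = b y x.
Hypothesis bD : forall x, {morph b x : y y' / y + y'}.
Hypothesis b_nondeg : forall x, (forall y, b x y = 0) -> x = 0.
Hypothesis qD : forall x y, q (x + y) = q x + q y + b x y.
Hypothesis card_H : #|H| = (g * g)%N.
Variables (R : realType) (theta : R).
Hypothesis theta_ge0 : 0 <= theta.
Hypothesis theta_lt1 : theta < 1.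

(** The total weight of the tuples with at least one nonzero coefficient, each
    nonzero coefficient contributing a factor [theta]. *)
Definition nonspecial_sum (n : nat) : R :=
  \sum_(h : {ffun 'I_n -> H} | ncoef b q h != 0) theta ^+ ncoef b q h.

(** The three cases of [tuple_trichotomy], turned into weights multiplicative
    in the entries of [h], so that their sums over [h] factor.  In the second
    case 1 <= kappa^-n tau^(number of entries outside L) because that number is
    at most n / K' and kappa^K' <= tau. *)
Lemma weight_bound (K K' n : nat) (nu kappa tau : R) (h : {ffun 'I_n -> H}) :
    K = (#|H| * K')%N -> (0 < K')%N -> 0 < nu < 1 -> theta <= nu ^+ (4 * K * K) ->
    0 < kappa < 1 -> kappa ^+ K' <= tau -> 0 <= tau -> ncoef b q h != 0%N ->
  theta ^+ ncoef b q h <= nu ^+ (n * (n - K)) +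
    \sum_(L : {set H} | (#|L| < g)%N) kappa ^- n * tau ^+ noutside L h +
    \sum_(L : {set H} | (#|L| <= g)%N)
       nu ^+ (n - K) * (nu ^+ (n - K)) ^+ noutside L h.
Proof.
move=> KE K'_gt0 /andP[nu0 nu1] theta_nu /andP[k0 k1] kt t0 h0.
have K_gt0 : (0 < K)%N.
  by rewrite KE muln_gt0 K'_gt0 andbT; apply/card_gt0P; exists 0.
have sum1 : 0 <= \sum_(L : {set H} | (#|L| < g)%N) kappa ^- n * tau ^+ noutside L h.
  by apply: sumr_ge0 => L _; rewrite mulr_ge0 ?invr_ge0 ?exprn_ge0 // ltW.
have sum2 : 0 <= \sum_(L : {set H} | (#|L| <= g)%N)
       nu ^+ (n - K) * (nu ^+ (n - K)) ^+ noutside L h.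
  by apply: sumr_ge0 => L _; rewrite mulr_ge0 ?exprn_ge0 // ltW.
have nu_ge0 m : 0 <= nu ^+ m by rewrite exprn_ge0 // ltW.
have theta_le m : (m <= 4 * K * K * ncoef b q h)%N -> theta ^+ ncoef b q h <= nu ^+ m.
  move=> le_m; apply: le_trans (_ : nu ^+ (4 * K * K * ncoef b q h) <= _).
    by rewrite exprM lerXn2r // nnegrE.
  by apply: ler_wiXn2l => //; exact: ltW.
have h_gt0 : (0 < ncoef b q h)%N by rewrite lt0n.
have [le1|[L Lg le2]|[L Lg le3]] :=
  tuple_trichotomy bC bD b_nondeg qD card_H KE K'_gt0 h_gt0.
- suff le_nu : theta ^+ ncoef b q h <= nu ^+ (n * (n - K)).
    by apply: le_trans le_nu _; rewrite -addrA lerDl addr_ge0.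
  apply: theta_le; apply: leq_trans le1 _.
  by rewrite !leq_mul.
- have theta1 : theta ^+ ncoef b q h <= 1 by rewrite exprn_ile1 // ltW.
  have : 1 <= kappa ^- n * tau ^+ noutside L h.
    rewrite mulrC ler_pdivlMr ?exprn_gt0 // mul1r.
    apply: le_trans (_ : (kappa ^+ K') ^+ noutside L h <= _).
      by rewrite -exprM; apply: ler_wiXn2l => //; exact: ltW.
    by rewrite lerXn2r // nnegrE // exprn_ge0 // ltW.
  have : kappa ^- n * tau ^+ noutside L h <=
     \sum_(L : {set H} | (#|L| < g)%N) kappa ^- n * tau ^+ noutside L h.
    rewrite (bigD1 L) //= lerDl; apply: sumr_ge0 => L' _.
    by rewrite mulr_ge0 ?invr_ge0 ?exprn_ge0 // ltW.
  move=> le_sum le_1; apply: le_trans theta1 (le_trans le_1 (le_trans le_sum _)).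
  by rewrite -addrA addrCA lerDl addr_ge0.
- have : theta ^+ ncoef b q h <= nu ^+ (n - K) * (nu ^+ (n - K)) ^+ noutside L h.
    rewrite -exprS -exprM theta_le //; apply: leq_trans le3 _.
    by rewrite leq_mul2r leq_pmulr ?orbT.
  have : nu ^+ (n - K) * (nu ^+ (n - K)) ^+ noutside L h <=
     \sum_(L : {set H} | (#|L| <= g)%N)
       nu ^+ (n - K) * (nu ^+ (n - K)) ^+ noutside L h.
    rewrite (bigD1 L) //= lerDl; apply: sumr_ge0 => L' _.
    by rewrite mulr_ge0 ?exprn_ge0 // ltW.
  move=> le_sum le_1; apply: le_trans le_1 (le_trans le_sum _).
  by rewrite lerDr addr_ge0.
Qed.

Lemma nonspecial_sum_bound (K K' n : nat) (nu kappa tau : R) :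
    K = (#|H| * K')%N -> (0 < K')%N -> 0 < nu < 1 -> theta <= nu ^+ (4 * K * K) ->
    0 < kappa < 1 -> kappa ^+ K' <= tau -> 0 <= tau ->
  nonspecial_sum n <= (#|H|%:R * nu ^+ (n - K)) ^+ n +
    (2 ^ #|H|)%:R * (kappa ^- n * (g%:R - 1 + tau * #|H|%:R) ^+ n) +
    (2 ^ #|H|)%:R * (nu ^+ (n - K) * (g%:R + nu ^+ (n - K) * #|H|%:R) ^+ n).
Proof.
move=> KE K'_gt0 nu01 theta_nu kappa01 kt t0.
have /andP[nu0 nu1] := nu01; have /andP[k0 k1] := kappa01.
have g_ge1 : 1 <= g%:R :> R.
  rewrite ler1n; have : (0 < #|H|)%N by apply/card_gt0P; exists 0.
  by rewrite card_H; case: g.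
have nu_ge0 m : 0 <= nu ^+ m by rewrite exprn_ge0 // ltW.
have base_ge0 : 0 <= g%:R - 1 + tau * #|H|%:R.
  by rewrite addr_ge0 ?subr_ge0 ?mulr_ge0 ?ler0n.
have card_sets (P : pred {set H}) (F : {set H} -> R) (c : R) : 0 <= c ->
    (forall L, P L -> F L <= c) -> \sum_(L | P L) F L <= (2 ^ #|H|)%:R * c.
  move=> c0 Fc; apply: le_trans (ler_sum _ Fc) _.
  rewrite (_ : \sum_(i | P i) c = c *+ #|P|); last by rewrite -sumr_const.
  rewrite -[c *+ _]mulr_natl ler_wpM2r // ler_nat.
  rewrite -cardsT -card_powerset; apply/subset_leq_card/fintype.subsetP => L _.
  by rewrite powersetE finset.subsetT.
pose W (h : {ffun 'I_n -> H}) : R := nu ^+ (n * (n - K)) +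
    \sum_(L : {set H} | (#|L| < g)%N) kappa ^- n * tau ^+ noutside L h +
    \sum_(L : {set H} | (#|L| <= g)%N)
       nu ^+ (n - K) * (nu ^+ (n - K)) ^+ noutside L h.
apply: le_trans (_ : \sum_h W h <= _).
  rewrite /nonspecial_sum big_mkcond /=; apply: ler_sum => h _.
  case: ifP => [h0|_]; first exact: (weight_bound KE).
  by rewrite !addr_ge0 ?sumr_ge0 // => L _;
    rewrite mulr_ge0 ?invr_ge0 ?exprn_ge0 // ltW.
rewrite /W !big_split /=; apply: lerD; first apply: lerD.
- rewrite sumr_const card_ffun card_ord -[_ *+ (_ ^ _)]mulr_natl exprMn natrX.
  by rewrite mulnC exprM.
- rewrite exchange_big /=; apply: card_sets => [|L Lg].
    by rewrite mulr_ge0 ?invr_ge0 ?exprn_ge0 ?base_ge0 ?(ltW k0).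
  rewrite -mulr_sumr ler_wpM2l ?invr_ge0 ?exprn_ge0 ?(ltW k0) //.
  apply: le_trans (sum_expr_noutside n L t0) _.
  have gL : #|L|%:R <= g%:R - 1 :> R by rewrite lerBrDr natr1 ler_nat.
  by rewrite lerXn2r ?nnegrE ?base_ge0 ?lerD2r // addr_ge0 ?mulr_ge0 ?ler0n.
- rewrite exchange_big /=; apply: card_sets => [|L Lg].
    by rewrite mulr_ge0 ?exprn_ge0 ?addr_ge0 ?mulr_ge0 ?ler0n ?(ltW nu0).
  rewrite -mulr_sumr ler_wpM2l //.
  apply: le_trans (sum_expr_noutside n L (nu_ge0 _)) _.
  by rewrite lerXn2r ?nnegrE ?addr_ge0 ?mulr_ge0 ?ler0n // lerD2r ler_nat.
Qed.

(** With tau |H| = 1/2 and kappa = 1 - 1/(4g), the second term of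
    [nonspecial_sum_bound] is at most 2^|H| ((g - 1/2) / (g - 1/4))^n g^n; the
    choice of tau and kappa fixes K', hence K, and then nu.  Once
    g nu^(n - K) is below (1 - nu)/2, the first and third terms divided by g^n
    also decay geometrically. *)
Lemma nonspecial_sum_cvg :
  (nonspecial_sum n / g%:R ^+ n @[n --> \oo] --> (0 : R))%classic.
Proof.
have g_gt0 : (0 < g)%N.
  have : (0 < #|H|)%N by apply/card_gt0P; exists 0.
  by rewrite card_H; case: g.
have g0 : 0 < g%:R :> R by rewrite ltr0n.
have g1 : 1 <= g%:R :> R by rewrite ler1n.
have HE : #|H|%:R = g%:R * g%:R :> R by rewrite card_H natrM.
pose tau : R := 1 / (2 * #|H|%:R).
have tau_gt0 : 0 < tau by rewrite divr_gt0 // mulr_gt0 // HE mulr_gt0.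
have tauH : tau * #|H|%:R = 1 / 2.
  by rewrite /tau HE; field; rewrite gt_eqF.
pose kappa : R := 1 - 1 / (4 * g%:R).
have kappa_gE : kappa * g%:R = g%:R - 1 / 4 by rewrite /kappa; field; rewrite gt_eqF.
have ginv : 1 / (4 * g%:R) * (4 * g%:R) = 1 :> R by rewrite divfK // gt_eqF // mulr_gt0.
have kappa0 : 0 < kappa by rewrite -(pmulr_lgt0 _ g0) kappa_gE; lra.
have kappa1 : kappa < 1 by rewrite -subr_gt0 opprB addrC subrK divr_gt0 // mulr_gt0.
have [K' K'_gt0 kt] := exists_expr_below (ltW kappa0) kappa1 tau_gt0.
pose K := (#|H| * K')%N.
have [nu [nu0 nu1 theta_nu]] := exists_root_above (4 * K * K) theta_ge0 theta_lt1.
pose del : R := (1 - nu) / 2.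
have del0 : 0 < del by rewrite /del; lra.
have delg0 : 0 < del / g%:R by rewrite divr_gt0.
have [N1 _ nuN] := exists_expr_below (ltW nu0) nu1 delg0.
pose r2 := (g%:R - 1 / 2) / (g%:R - 1 / 4) : R.
have r2_ge0 : 0 <= r2 by rewrite divr_ge0 //; lra.
have r2_lt1 : r2 < 1 by rewrite ltr_pdivrMr; lra.
pose r3 := nu * (1 + del).
have r3_lt1 : r3 < 1 by rewrite /r3 /del; nra.
have r3_ge0 : 0 <= r3 by rewrite mulr_ge0 //; lra.
pose M : R := (2 ^ #|H|)%:R.
have M0 : 0 <= M by rewrite ler0n.
pose r := Num.max del (Num.max r2 r3).
have del_r : del <= r by rewrite /r le_max lexx.
have r2_r : r2 <= r by rewrite /r !le_max lexx orbT.
have r3_r : r3 <= r by rewrite /r !le_max lexx !orbT.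
have r_lt1 : r < 1 by rewrite /r !gt_max r2_lt1 r3_lt1 /del; apply/andP; split => //; lra.
apply: (@geometric_squeeze _ _ (1 + M + M * nu ^- K) r (N1 + K)) => //.
  by apply: le_trans del_r; exact: ltW.
move=> n N_n; have Kn : (K <= n)%N by apply: leq_trans N_n; rewrite leq_addl.
have gn0 : 0 < g%:R ^+ n :> R by rewrite exprn_gt0.
have r_ge0 : 0 <= r by apply: le_trans del_r; exact: ltW.
apply/andP; split.
  by rewrite divr_ge0 ?(ltW gn0) // sumr_ge0 // => h _; rewrite exprn_ge0.
set u := nu ^+ (n - K).
have u0 : 0 < u by rewrite exprn_gt0.
have ug : u * g%:R <= del.
  rewrite -ler_pdivlMr //; apply: le_trans nuN; apply: ler_wiXn2l => //.
  - exact: ltW.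
  - exact: ltW.
  - by rewrite leq_subRL // addnC.
rewrite ler_pdivrMr //.
have := @nonspecial_sum_bound K K' n nu kappa tau erefl K'_gt0.
rewrite nu0 nu1 kappa0 kappa1 => /(_ isT theta_nu isT kt (ltW tau_gt0)).
rewrite -/u -/M => /le_trans; apply; rewrite mulrDl mulrDl !mulrDl mul1r.
apply: lerD; first apply: lerD.
- have -> : #|H|%:R * u = u * g%:R * g%:R by rewrite HE; ring.
  rewrite exprMn ler_wpM2r ?(ltW gn0) //.
  rewrite lerXn2r ?nnegrE ?mulr_ge0 ?(ltW u0) ?(ltW g0) //.
  exact: le_trans del_r.
- rewrite -[M * r ^+ n * _]mulrA ler_wpM2l // tauH -exprVn -exprMn -exprMn lerXn2r ?nnegrE //.
  + by rewrite mulr_ge0 ?invr_ge0 ?(ltW kappa0) //; lra.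
  + by rewrite mulr_ge0 ?(ltW g0).
  rewrite mulrC ler_pdivrMr // -mulrA [g%:R * _]mulrC kappa_gE.
  apply: le_trans (_ : r2 * (g%:R - 1 / 4) <= _); last by rewrite ler_wpM2r //; lra.
  by rewrite divfK ?gt_eqF //; lra.
- rewrite -[M / _ * _ * _]mulrA -[M / _ * _]mulrA ler_wpM2l // HE.
  have -> : g%:R + u * (g%:R * g%:R) = (1 + u * g%:R) * g%:R by ring.
  rewrite exprMn !mulrA ler_wpM2r ?(ltW gn0) //.
  have uE : u = nu ^- K * nu ^+ n by rewrite mulrC /u expfB_cond ?gt_eqF.
  apply: le_trans (_ : u * (1 + del) ^+ n <= _).
    rewrite ler_wpM2l ?(ltW u0) // lerXn2r ?nnegrE //; last by rewrite lerD2l.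
    - by rewrite addr_ge0 ?mulr_ge0 ?(ltW u0) ?(ltW g0).
    - by rewrite addr_ge0 ?(ltW del0).
  rewrite uE -mulrA ler_wpM2l ?invr_ge0 ?exprn_ge0 ?(ltW nu0) // -exprMn.
  by rewrite lerXn2r ?nnegrE.
Qed.

End NonspecialSum.

(** * Surjections from a cokernel *)

Section CokernelSurjections.
Variables (a : nat) (G : finZmodType) (n : nat).
Local Notation A := (Zmod a).
Hypothesis G_exp : forall x : G, x *+ a.-1.+1 = 0.
Implicit Types (F : {ffun 'I_n -> G}) (v : 'cV[A]_n) (M : 'M[A]_n).

(** The homomorphism A^n -> G with values [F] on the standard basis. *)
Definition lincomb F v : G := \sum_j F j *+ (v j 0 : nat).

Lemma lincombD F : {morph lincomb F : u v / u + v}.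
Proof.
move=> u v; rewrite /lincomb -big_split /=; apply: eq_bigr => j _.
by rewrite mxE mulrn_ZmodD.
Qed.

Lemma lincomb0 F : lincomb F 0 = 0.
Proof. by rewrite /lincomb big1 // => j _; rewrite mxE mulr0n. Qed.

Lemma lincombMn F v k : lincomb F (v *+ k) = lincomb F v *+ k.
Proof.
elim: k => [|k IHk]; first by rewrite !mulr0n lincomb0.
by rewrite !mulrS lincombD IHk.
Qed.

Lemma lincomb_sum F (I : finType) (V : I -> 'cV[A]_n) :
  lincomb F (\sum_i V i) = \sum_i lincomb F (V i).
Proof. exact: (big_morph _ (lincombD F) (lincomb0 F)). Qed.

Lemma Zmod_col_sum v : v = \sum_j delta_mx j 0 *+ (v j 0 : nat).
Proof.
rewrite [LHS](_ : v = \sum_j v j 0 *: delta_mx j 0); last first.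
  apply/matrixP => i k; rewrite ord1 summxE (bigD1 i) //= big1 => [|j ji].
    by rewrite !mxE !eqxx addr0 mulr1.
  by rewrite !mxE eq_sym (negPf ji) mulr0.
apply: eq_bigr => j _; apply/matrixP => i k.
by rewrite mulmxnE !mxE Zmod_mulrn mulrC.
Qed.

Lemma lincomb_delta F j : lincomb F (delta_mx j 0) = F j.
Proof.
rewrite /lincomb (bigD1 j) //= big1 => [|i ij].
  by rewrite mxE !eqxx addr0 (Zmod_val_mulrn 1 (G_exp _)).
by rewrite mxE (negPf ij).
Qed.

Definition generating F : bool := [forall y, exists v, lincomb F v == y].

Definition annihilates F M : bool := [forall i, lincomb F (col i M) == 0].

Lemma generatingP F : reflect (forall y, exists v, lincomb F v = y) (generating F).
Proof.
apply: (iffP forallP) => genF y.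
  by have /existsP[v /eqP] := genF y; exists v.
by apply/existsP; have [v <-] := genF y; exists v; rewrite eqxx.
Qed.

Lemma mulmx_col_sum M v : M *m v = \sum_i col i M *+ (v i 0 : nat).
Proof.
rewrite {1}[v]Zmod_col_sum mulmx_sumr; apply: eq_bigr => i _.
by rewrite raddfMn /= colE.
Qed.

Lemma annihilates_image F M v : annihilates F M -> lincomb F (M *m v) = 0.
Proof.
move=> /forallP FM; rewrite mulmx_col_sum lincomb_sum big1 // => i _.
by rewrite lincombMn (eqP (FM i)) mul0rn.
Qed.


Section Surjections.
Variable M : 'M[A]_n.
Local Notation I := (mulmx_image M).

Lemma norm_mulmx_image v : v \in 'N(I)%g.
Proof.
apply: (fintype.subsetP (cents_norm _)) (finset.in_setT v).
by apply/centsP => u _ w _; exact: addrC.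
Qed.

Lemma repr_cosetE v : exists u, repr (coset I v) = M *m u + v.
Proof.
have := mem_repr_coset (coset I v); rewrite val_coset ?norm_mulmx_image //.
by case/rcosetP => w /imsetP[u _ ->] ->; exists u.
Qed.

Lemma coset_surj (x : coker M) : exists v, x = coset I v.
Proof. by exists (repr x); rewrite coset_reprK. Qed.

Lemma coset_mulmxD u v : coset I (u + v) = (coset I u * coset I v)%g.
Proof. exact: (morphM (coset_morphism _) (norm_mulmx_image u) (norm_mulmx_image v)). Qed.

Definition on_basis (f : {ffun coker M -> G}) : {ffun 'I_n -> G} :=
  [ffun j => f (coset I (delta_mx j 0))].

Definition from_basis F : {ffun coker M -> G} :=
  [ffun x : coker M => lincomb F (repr x)].

(** Surjections of the cokernel, seen as additive functions of vectors. *)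
Lemma SurP (f : {ffun coker M -> G}) :
  reflect ((forall u v, f (coset I (u + v)) = f (coset I u) + f (coset I v)) /\
           (forall y, exists v, f (coset I v) = y))
          (f \in Sur (coker M) G).
Proof.
rewrite inE; apply: (iffP andP) => -[f_mor f_surj]; split.
- move=> u v; rewrite coset_mulmxD.
  by apply: (morphicP f_mor); rewrite finset.in_setT.
- move=> y; have /existsP[x /eqP <-] := forallP f_surj y.
  by have [v ->] := coset_surj x; exists v.
- apply/morphicP => x y _ _; have [u ->] := coset_surj x.
  by have [v ->] := coset_surj y; rewrite -coset_mulmxD.
- apply/forallP => y; apply/existsP; have [v <-] := f_surj y.
  by exists (coset I v); rewrite eqxx.
Qed.

Lemma Sur_lincomb f v : f \in Sur (coker M) G ->
  f (coset I v) = lincomb (on_basis f) v.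
Proof.
case/SurP => fD _.
have f0 : f (coset I 0) = 0 by apply: (addrI (f (coset I 0))); rewrite -fD !addr0.
have fMn u k : f (coset I (u *+ k)) = f (coset I u) *+ k.
  by elim: k => [|k IHk]; rewrite ?mulr0n // !mulrS fD IHk.
rewrite {1}[v]Zmod_col_sum (big_morph (fun u => f (coset I u)) fD f0).
by apply: eq_bigr => j _; rewrite fMn ffunE.
Qed.

Lemma from_basisE F v : annihilates F M -> from_basis F (coset I v) = lincomb F v.
Proof.
move=> FM; rewrite ffunE; have [u ->] := repr_cosetE v.
by rewrite lincombD annihilates_image // add0r.
Qed.

(** A homomorphism from the cokernel is determined by its values on the
    standard basis, and a tuple [F] comes from one exactly when it kills the
    columns of [M]. *)
Lemma card_Sur :
  #|Sur (coker M) G| = #|[set F | generating F && annihilates F M]|.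
Proof.
have inj : {in Sur (coker M) G &, injective on_basis}.
  move=> f f' Sf Sf' eqb; apply/ffunP => x; have [v ->] := coset_surj x.
  by rewrite !Sur_lincomb // eqb.
rewrite -(card_in_imset inj); apply: eq_card => F; rewrite [RHS]inE.
apply/imsetP/andP => [[f Sf ->]|[/generatingP genF FM]].
  have /SurP[fD f_surj] := Sf; split.
    apply/generatingP => y; have [v <-] := f_surj y; exists v.
    by rewrite Sur_lincomb.
  apply/forallP => i; rewrite -Sur_lincomb // colE.
  have -> : coset I (M *m delta_mx i 0) = coset I 0.
    by rewrite !coset_id ?(group1 (mulmx_image_group M)) ?imset_f.
  by apply/eqP/(addrI (f (coset I 0))); rewrite -fD !addr0.
exists (from_basis F).
  apply/SurP; split=> [u v|y]; first by rewrite !from_basisE // lincombD.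
  by have [v <-] := genF y; exists v; rewrite from_basisE.
by apply/ffunP => j; rewrite ffunE from_basisE // lincomb_delta.
Qed.

End Surjections.
End CokernelSurjections.

(** * Special tuples and alternating forms *)

Lemma sum_ffun_pair (M : nmodType) (I U V : finType)
    (f : {ffun I -> U} -> {ffun I -> V} -> M) :
  \sum_F \sum_psi f F psi =
  \sum_(h : {ffun I -> U * V}) f [ffun i => (h i).1] [ffun i => (h i).2].
Proof.
rewrite pair_big /=.
pose mk (h : {ffun I -> U * V}) := ([ffun i => (h i).1], [ffun i => (h i).2]).
rewrite (reindex mk) //.
exists (fun p : {ffun I -> U} * {ffun I -> V} => [ffun i => (p.1 i, p.2 i)]).
  by move=> h _; apply/ffunP => i; rewrite !ffunE -surjective_pairing.
by move=> [F psi] _; congr pair; apply/ffunP => i; rewrite !ffunE.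
Qed.

Section HyperbolicForm.
Variables (a : nat) (G : finZmodType).
Local Notation A := (Zmod a).
Hypothesis G_exp : forall x : G, x *+ a.-1.+1 = 0.

(** The group G x dual G with the evaluation form [hyp_q], its hyperbolic
    quadratic form, and the polarisation [hyp_b]. *)
Definition doubled : finZmodType := (G * dual a G)%type.
Local Notation H := doubled.

Definition hyp_q (x : H) : A := x.2 x.1.
Definition hyp_b (x y : H) : A := x.2 y.1 + y.2 x.1.

Lemma hyp_bC x y : hyp_b x y = hyp_b y x.
Proof. exact: addrC. Qed.

Lemma hyp_bD x : {morph hyp_b x : y y' / y + y'}.
Proof. by move=> y y'; rewrite /hyp_b dualD add_dualE addrACA. Qed.

Lemma hyp_qD x y : hyp_q (x + y) = hyp_q x + hyp_q y + hyp_b x y.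
Proof.
case: x y => [g f] [g' f']; rewrite /hyp_q /hyp_b /= add_dualE !dualD.
by rewrite [f' g + _]addrC addrACA.
Qed.

Lemma hyp_nondeg x : (forall y, hyp_b x y = 0) -> x = 0.
Proof.
case: x => g f bx.
have f0 : f = 0.
  by apply: dualP => y; have := bx (y, 0); rewrite /hyp_b /= !zero_dualE addr0.
have g0 : g = 0.
  apply/eqP; apply: contraT => /(dual_separates G_exp)[f'].
  by have := bx (0, f'); rewrite /hyp_b /= raddf0 add0r => ->; rewrite eqxx.
by rewrite f0 g0.
Qed.

Lemma card_doubled : #|H| = (#|G| * #|G|)%N.
Proof. by rewrite card_prod card_dual. Qed.

End HyperbolicForm.

Section SpecialTuples.
Variables (a : nat) (G : finZmodType) (n : nat).
Local Notation A := (Zmod a).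
Local Notation H := (doubled a G).
Local Notation generating := (generating a).
Hypothesis G_exp : forall x : G, x *+ a.-1.+1 = 0.

(** Alternating bilinear forms on [G], encoded as homomorphisms from [G] to its
    dual. *)
Definition alternating_forms : {set {ffun G -> dual a G}} :=
  [set B : {ffun G -> dual a G} |
    [forall x, forall y, B (x + y) == B x + B y] && [forall x, B x x == 0]].

Lemma alternating_formsP (B : {ffun G -> dual a G}) :
  reflect ({morph B : x y / x + y} /\ forall x, B x x = 0)
          (B \in alternating_forms).
Proof.
rewrite inE; apply: (iffP andP) => -[B_D B0]; split.
- by move=> x y; have /forallP/(_ y)/eqP := forallP B_D x.
- by move=> x; apply/eqP; have /forallP := B0.
- by apply/forallP => x; apply/forallP => y; rewrite B_D.
- by apply/forallP => x; rewrite B0.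
Qed.

Lemma alternating_skew (B : {ffun G -> dual a G}) x y :
  B \in alternating_forms -> B x y + B y x = 0.
Proof.
case/alternating_formsP => B_D B0; have := B0 (x + y).
by rewrite B_D add_dualE !dualD !B0 addr0 add0r.
Qed.

Implicit Types (h : {ffun 'I_n -> H}) (F : {ffun 'I_n -> G}) (v w : 'cV[A]_n).

Definition tuple_fst h : {ffun 'I_n -> G} := [ffun i => (h i).1].
Definition tuple_snd h : {ffun 'I_n -> dual a G} := [ffun i => (h i).2].
(** All coefficients of [h] vanish, that is, [h] takes its values in a totally
    isotropic subgroup. *)
Definition special_tuple h : bool := ncoef (@hyp_b a G) (@hyp_q a G) h == 0%N.
Definition graph_tuple F (B : {ffun G -> dual a G}) : {ffun 'I_n -> H} :=
  [ffun i => (F i, B (F i))].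

Lemma graph_tupleE F B i : graph_tuple F B i = (F i, B (F i)).
Proof. exact: ffunE. Qed.

Lemma specialP h : reflect
  ((forall i, hyp_q (h i) = 0) /\ (forall i j, hyp_b (h i) (h j) = 0)) (special_tuple h).
Proof.
rewrite /special_tuple /ncoef cards_eq0; apply: (iffP eqP) => [h0|[q0 b0]].
  have coef0 (i j : 'I_n) (ij : (i <= j)%N) :
      (if i == j then hyp_q (h i) else hyp_b (h i) (h j)) = 0.
    have := finset.in_set0 (exist _ (i, j) ij : upper_index n).
    by rewrite -h0 inE /coef /= => /negbFE/eqP.
  have q0 i : hyp_q (h i) = 0 by have := coef0 i i (leqnn i); rewrite eqxx.
  split=> // i j; case: (eqVneq i j) => [<-|ij].
    by rewrite /hyp_b -/(hyp_q (h i)) q0 addr0.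
  wlog le_ij : i j ij / (i <= j)%N => [hw|].
    case/orP: (leq_total i j) => le; first exact: hw.
    by rewrite hyp_bC; apply: hw; rewrite // eq_sym.
  by have := coef0 i j le_ij; rewrite (negPf ij).
apply/setP => -[[i j] ij]; rewrite inE finset.in_set0 /coef /=.
by rewrite q0 b0 if_same eqxx.
Qed.

(** The form vanishes on the subgroup generated by the values of a special
    tuple: its elements lie in the orthogonal and in the double orthogonal of
    these values, where [hyp_q] is additive. *)
Lemma special_lincomb h v w : special_tuple h ->
  hyp_q (lincomb h v) = 0 /\ hyp_b (lincomb h v) (lincomb h w) = 0.
Proof.
case/specialP => q0 b0; pose S := [set h i | i in 'I_n].
pose P x := hyp_q x = 0 /\ x \in perp (@hyp_b a G) S /\
            x \in perp (@hyp_b a G) (perp (@hyp_b a G) S).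
have hS i : h i \in S by apply/imsetP; exists i.
have P0 : P 0.
  split; last by split; apply: perp0; exact: hyp_bD.
  by rewrite /P /hyp_q raddf0.
have PD x y : P x -> P y -> P (x + y).
  have permD S' (u v' : H) : u \in perp (@hyp_b a G) S' -> v' \in perp (@hyp_b a G) S' ->
      u + v' \in perp (@hyp_b a G) S'.
    by move=> /perpP Su /perpP Sv; apply/perpP => s Ss; rewrite hyp_bD Su ?Sv ?addr0.
  move=> [qx [Sx SSx]] [qy [Sy SSy]]; split; last by split; apply: permD.
  by rewrite hyp_qD qx qy (perpP _ _ _ SSy) ?addr0.
have Plin (u : 'cV[A]_n) : P (lincomb h u).
  apply: (big_ind P) => // i _; elim: (nat_of_ord _) => [|k IHk].
    by rewrite mulr0n.
  rewrite mulrS; apply: PD => //; split; first exact: q0.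
  split; last exact: (fintype.subsetP (sub_perp_perp (@hyp_bC a G) S)).
  by apply/perpP => _ /imsetP[j _ ->].
split; first by case: (Plin v).
by have [_ [Sv _]] := Plin v; have [_ [_ /perpP]] := Plin w; apply.
Qed.

Lemma lincomb_pair h v :
  lincomb h v = (lincomb (tuple_fst h) v, lincomb (tuple_snd h) v) :> H.
Proof.
rewrite /lincomb; elim/big_rec3: _ => // i x y u _ ->.
by rewrite pair_mulrn !ffunE.
Qed.

Lemma alternating_lincomb F B v : B \in alternating_forms ->
  B (lincomb F v) = lincomb [ffun i => B (F i)] v.
Proof.
case/alternating_formsP => B_D _.
have B0 : B 0 = 0 by apply: (addrI (B 0)); rewrite -B_D !addr0.
have BMn x k : B (x *+ k) = B x *+ k.
  by elim: k => [|k IHk]; rewrite ?mulr0n // !mulrS B_D IHk.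
rewrite /lincomb (big_morph B B_D B0); apply: eq_bigr => i _.
by rewrite BMn ffunE.
Qed.

Lemma graph_tuple_special F B : B \in alternating_forms -> special_tuple (graph_tuple F B).
Proof.
move=> altB; have /alternating_formsP[B_D B0] := altB.
apply/specialP; split=> [i|i j]; rewrite !ffunE /hyp_q /hyp_b //=.
exact: alternating_skew.
Qed.

Lemma graph_tuple_inj F : generating F ->
  {in alternating_forms &, injective (graph_tuple F)}.
Proof.
move=> /generatingP genF B B' altB altB' eqB; apply/ffunP => x.
have [v <-] := genF x; rewrite !alternating_lincomb //; congr lincomb.
by apply/ffunP => i; have := congr1 (fun f : {ffun 'I_n -> H} => (f i).2) eqB; rewrite !ffunE.
Qed.

(** When the first components generate [G], the isotropic subgroup generated by
    [h] projects onto [G], and injectively since (0, chi) orthogonal to it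
    forces chi = 0.  It is thus the graph of a homomorphism from [G] to its
    dual, which is alternating because [hyp_q] vanishes on the graph. *)
Lemma special_graph h : generating (tuple_fst h) -> special_tuple h ->
  exists2 B, B \in alternating_forms & h = graph_tuple (tuple_fst h) B.
Proof.
move=> genF sp_h; have gen x := forallP genF x.
pose F := tuple_fst h; pose psi := tuple_snd h.
pose coord x : 'cV[A]_n := xchoose (existsP (gen x)).
have coordK x : lincomb F (coord x) = x by apply/eqP/(xchooseP (existsP (gen x))).
have F_psi v w : lincomb F v = lincomb F w -> lincomb psi v = lincomb psi w.
  move=> eqF; apply/eqP; rewrite -subr_eq0; apply/eqP.
  have linB (V : finZmodType) (E : {ffun 'I_n -> V}) : (forall x : V, x *+ a.-1.+1 = 0) ->
      lincomb E v - lincomb E w = lincomb E (v - w).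
    by move=> V_exp; apply/eqP; rewrite subr_eq -lincombD // subrK.
  apply: dualP => x; rewrite zero_dualE -{1}[x]coordK linB; last exact: dual_exp.
  have [_] := special_lincomb (v - w) (coord x) sp_h.
  have F0 : lincomb F (v - w) = 0 by rewrite -linB // eqF subrr.
  by rewrite /hyp_b !lincomb_pair /= -/F F0 raddf0 addr0.
pose B := [ffun x => lincomb psi (coord x)].
exists B.
  apply/alternating_formsP; split=> [x y|x]; rewrite !ffunE.
    rewrite -lincombD; last exact: dual_exp.
    by apply: F_psi; rewrite lincombD // !coordK.
  have [] := special_lincomb (coord x) 0 sp_h.
  by rewrite /hyp_q lincomb_pair /= -/F -/psi coordK.
apply/ffunP => i; rewrite !ffunE [LHS]surjective_pairing; congr pair.
have -> : (h i).2 = psi i by rewrite ffunE.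
rewrite -[LHS](lincomb_delta (@dual_exp a G)).
apply: F_psi; rewrite coordK lincomb_delta //.
by rewrite ffunE.
Qed.

Lemma sum_special (M : nmodType) (f : {ffun 'I_n -> H} -> M) :
  \sum_(h | generating (tuple_fst h) && special_tuple h) f h =
  \sum_(F | generating F) \sum_(B in alternating_forms) f (graph_tuple F B).
Proof.
rewrite (partition_big tuple_fst (fun F => generating F)) => [|h /andP[]//].
apply: eq_bigr => F genF; rewrite -(big_imset f (graph_tuple_inj genF)).
apply: eq_bigl => h; apply/andP/imsetP => [[/andP[gen_h sp_h] /eqP hF]|[B altB ->]].
  by have [B altB ->] := special_graph gen_h sp_h; exists B; rewrite // hF.
have fstE : tuple_fst (graph_tuple F B) = F by apply/ffunP => i; rewrite !ffunE.
by rewrite fstE genF graph_tuple_special ?eqxx.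
Qed.

End SpecialTuples.

(** * Fourier expansion of the moments *)

Section CharacteristicFunction.
Variables (a : nat) (R : realType) (z : R[i]).
Local Notation A := (Zmod a).
Local Notation e := (root_char z).
Hypothesis z_prim : (a.-1.+1).-primitive_root z.

Lemma root_char_Re_lt1 (w : A) : w != 0 -> complex.Re (e w) < 1.
Proof.
move=> w0; have norm1 := norm_root_char z_prim w.
have sq1 : complex.Re (e w) ^+ 2 + complex.Im (e w) ^+ 2 = 1.
  by apply: complexI; rewrite add_Re2_Im2 norm1 expr1n.
rewrite ltNge; apply: contra w0 => Re_ge1.
have Im2 := sqr_ge0 (complex.Im (e w)).
have Re1 : complex.Re (e w) = 1 by nra.
have Im0 : complex.Im (e w) = 0.
  by apply/eqP; rewrite -sqrf_eq0; apply/eqP; move: sq1; rewrite Re1; lra.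
rewrite -(root_char_eq1 z_prim) [e w]complexE Re1 Im0.
by rewrite rmorph0 mulr0 addr0 rmorph1.
Qed.

Lemma root_char_gap : exists kappa : R, 0 < kappa <= 1 /\
  forall w : A, w != 0 -> complex.Re (e w) <= 1 - kappa.
Proof.
suff [k [k01 Hk]] : exists kappa : R, 0 < kappa <= 1 /\
    forall w : A, w \in enum {: A} -> w != 0 -> complex.Re (e w) <= 1 - kappa.
  by exists k; split=> // w; apply: Hk; rewrite mem_enum.
elim: (enum {: A}) => [|v s [k [/andP[k0 k1] Hk]]].
  by exists 1; split=> //; rewrite ltr01 lexx.
have [->|v0] := eqVneq v 0.
  exists k; split; first by rewrite k0 k1.
  by move=> w; rewrite inE => /orP[/eqP ->|/Hk //]; rewrite eqxx.
exists (Num.min k (1 - complex.Re (e v))); split.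
  by rewrite lt_min k0 subr_gt0 root_char_Re_lt1 // ge_min k1.
move=> w; rewrite inE => /orP[/eqP -> _|ws w0].
  by rewrite lerBrDr -lerBrDl ge_min lexx orbT.
apply: le_trans (Hk w ws w0) _.
by rewrite lerD2l lerN2 ge_min lexx.
Qed.

Definition char_fun (p : A -> R) (c : A) : R[i] := \sum_x (p x)%:C%C * e (c * x).

(** What an epsilon-balanced variable with law [p] satisfies: since c <> 0 its
    annihilator is a proper ideal, so c N avoids each value c x with
    probability at least eps. *)
Definition balanced_law (eps : R) (p : A -> R) : Prop :=
  [/\ forall x, 0 <= p x, \sum_x p x = 1 &
      forall c x, c != 0 -> \sum_(y | c * (y - x) == 0) p y <= 1 - eps].

(** |E e(c N)|^2 is the expectation of Re e(c (N - N')) for an independent copy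
    N'.  This real part is at most 1 - k unless c N = c N', and the latter has
    conditional probability at most 1 - eps given N. *)
Lemma char_fun_bound (eps : R) : 0 < eps -> exists2 theta : R, 0 <= theta < 1 &
  forall p c, balanced_law eps p -> c != 0 -> `|char_fun p c| <= theta%:C%C.
Proof.
move=> eps0; have [k [/andP[k0 k1] Hk]] := root_char_gap.
(* Truncating [eps] at 1 keeps the bound nonnegative. *)
pose eps1 := Num.min eps 1.
have eps1_gt0 : 0 < eps1 by rewrite lt_min eps0 ltr01.
have eps1_le1 : eps1 <= 1 by rewrite ge_min lexx orbT.
have eps1_le : eps1 <= eps by rewrite ge_min lexx.
exists (1 - k * eps1 / 2); first by apply/andP; split; nra.
move=> p c [p0 p1 p_bal] c0; set theta := 1 - _.
have theta0 : 0 <= theta by rewrite /theta; nra.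
have ReD : {morph @complex.Re R : u v / u + v >-> u + v} by case=> ? ? [].
have Re0 : complex.Re (0 : R[i]) = 0 by [].
have ReM (r : R) (w : R[i]) : complex.Re (r%:C%C * w) = r * complex.Re w.
  by case: w => u v /=; rewrite mul0r subr0.
have -> : theta%:C%C = `|theta%:C%C| by rewrite ger0_norm ?ler0c.
rewrite -ler_sqr ?nnegrE // [X in _ <= X ^+ 2]ger0_norm ?ler0c //.
have -> : theta%:C%C ^+ 2 = (theta ^+ 2)%:C%C by rewrite rmorphXn.
have -> : `|char_fun p c| ^+ 2 =
    (\sum_x \sum_y p x * p y * complex.Re (e (c * (x - y))))%:C%C.
  have conjS : (char_fun p c)^* = \sum_y (p y)%:C%C * e (- (c * y)).
    rewrite /char_fun rmorph_sum; apply: eq_bigr => y _.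
    rewrite root_charN // [LHS]rmorphM; congr (_ * _).
    by apply: conj_Creal; rewrite ger0_real // ler0c.
  rewrite -[LHS]RRe_real; last by rewrite realX // normr_real.
  congr (_%:C)%C; rewrite normCK conjS /char_fun mulr_suml (big_morph _ ReD Re0).
  apply: eq_bigr => x _; rewrite mulr_sumr (big_morph _ ReD Re0).
  apply: eq_bigr => y _.
  by rewrite mulrACA -root_charD // -mulrBr -rmorphM ReM.
rewrite lecR; apply: le_trans (_ : 1 - k * eps1 <= _); last by rewrite /theta; nra.
have -> : 1 - k * eps1 = \sum_x p x * (1 - k * eps1) by rewrite -mulr_suml p1 mul1r.
apply: ler_sum => x _; rewrite -(eq_bigr _ (fun y _ => mulrA (p x) (p y) _)) -mulr_sumr.
rewrite ler_wpM2l //.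
apply: le_trans (_ : \sum_y (p y * (1 - k) + (if c * (y - x) == 0 then k * p y else 0)) <= _).
  apply: ler_sum => y _; have -> : (c * (y - x) == 0) = (c * (x - y) == 0).
    by rewrite -oppr_eq0 -mulrN opprB.
  have := p0 y; case: eqVneq => [->|cxy] py; first by rewrite root_char0 /=; nra.
  by rewrite addr0 ler_wpM2l // Hk.
rewrite big_split /= -mulr_suml p1 mul1r -big_mkcond /= -mulr_sumr.
by have := p_bal c x c0; nra.
Qed.

End CharacteristicFunction.

Section Fourier.
Variables (a : nat) (R : realType) (z : R[i]).
Local Notation A := (Zmod a).
Local Notation e := (root_char z).
Hypothesis z_prim : (a.-1.+1).-primitive_root z.
Variable G : finZmodType.
Hypothesis G_exp : forall x : G, x *+ a.-1.+1 = 0.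
Variables (n : nat) (Cm : 'M[A]_n).
Local Notation H := (doubled a G).
Local Notation generating := (generating a).
Local Notation hcoef := (coef (@hyp_b a G) (@hyp_q a G)).
Implicit Types (h : {ffun 'I_n -> H}) (F : {ffun 'I_n -> G}) (X : 'M[A]_n).

(** The constant subtracted from the Fourier exponent of [h] when the lower
    entries X_ji are rewritten as X_ij - C_ij. *)
Definition twist h : A :=
  \sum_(i < n) \sum_(j < n | (i <= j)%N) (h i).2 (h j).1 * Cm i j.

Lemma dual_lincomb (f : dual a G) F (v : 'cV[A]_n) :
  f (lincomb F v) = \sum_j f (F j) * v j 0.
Proof.
by rewrite raddf_sum; apply: eq_bigr => j _; rewrite raddfMn /= Zmod_mulrn.
Qed.

Lemma symmetric_pairing X h : symmetric_for Cm X ->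
  \sum_i (h i).2 (lincomb (tuple_fst h) (col i X)) =
  \sum_(ij : upper_index n) hcoef h ij * X (val ij).1 (val ij).2 - twist h.
Proof.
move=> symX; have Xji i j : X j i = X i j - Cm i j.
  by rewrite -symX !mxE opprB addrC subrK.
pose f i j := (h i).2 (h j).1.
transitivity (\sum_(i < n) \sum_(j < n) f i j * X j i).
  apply: eq_bigr => i _; rewrite dual_lincomb; apply: eq_bigr => j _.
  by rewrite ffunE mxE.
have -> : \sum_(ij : upper_index n) hcoef h ij * X (val ij).1 (val ij).2 =
   \sum_(i < n) \sum_(j < n | (i <= j)%N)
     (f i j + (if (i < j)%N then f j i else 0)) * X i j.
  rewrite -(big_upper_index _ (fun i j : 'I_n =>
    (f i j + (if (i < j)%N then f j i else 0)) * X i j)).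
  apply: eq_bigr => -[[i j] ij] _; rewrite /coef /=; congr (_ * _).
  rewrite ltn_neqAle ij andbT -[(i : nat) != j]/(i != j).
  by case: eqVneq => [->|_]; rewrite /hyp_q /hyp_b ?addr0.
rewrite /twist -sumrB.
under [RHS]eq_bigr => i _.
  rewrite -sumrB (eq_bigr (fun j => f i j * X j i +
    (if (i < j)%N then f j i * X i j else 0))) => [|j ij]; last first.
    by rewrite (Xji i j) mulrDl mulrBr addrAC; case: ifP => _; rewrite ?mul0r.
  rewrite big_split /= -big_mkcondr /=.
  over.
rewrite big_split /= [X in _ = _ + X](exchange_big_dep predT) //= -big_split /=.
apply: eq_bigr => i _; rewrite (bigID (fun j : 'I_n => (i <= j)%N)) /=.
congr (_ + _); apply: eq_bigl => j; rewrite -ltnNge.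
by case: (ltnP j i) => [ji|]; rewrite ?andbF // andbT ltnW.
Qed.


(** Fourier inversion on G^n: the indicator of F X = 0 is the average of
    e(psi (F X)) over psi in the dual of G^n. *)
Lemma count_fourier X :
  (#|[set F : {ffun 'I_n -> G} | generating F && annihilates F X]|%:R : R[i]) =
  #|G|%:R ^- n * \sum_(h : {ffun 'I_n -> H} | generating (tuple_fst h))
     e (\sum_i (h i).2 (lincomb (tuple_fst h) (col i X))).
Proof.
have G0 : #|G|%:R != 0 :> R[i].
  by rewrite pnatr_eq0 -lt0n; apply/card_gt0P; exists 0.
rewrite -sum1dep_card natr_sum big_mkcondr /= mulr_sumr.
rewrite [RHS]big_mkcond /= big_mkcond /=.
pose f (F : {ffun 'I_n -> G}) (psi : {ffun 'I_n -> dual a G}) : R[i] :=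
  if generating F then
  #|G|%:R ^- n * e (\sum_i psi i (lincomb F (col i X))) else 0.
transitivity (\sum_F \sum_psi f F psi); last first.
  rewrite sum_ffun_pair; apply: eq_bigr => h _; rewrite /f -/(tuple_fst h).
  by case: ifP => // _; congr (_ * e _); apply: eq_bigr => i _; rewrite ffunE.
apply: eq_bigr => F _; rewrite /f; case: ifP => [genF|_]; last by rewrite big1.
rewrite -mulr_sumr (eq_bigr _ (fun psi _ => root_char_sum z_prim _ _)).
rewrite -(bigA_distr_bigA (fun i (chi : dual a G) => e (chi (lincomb F (col i X))))).
rewrite (eq_bigr _ (fun i _ => sum_dual_root_char G_exp _ z_prim)) card_dual //.
case: ifP => [/forallP FX|/negbT].
  rewrite (eq_bigr (fun=> #|G|%:R)) => [|i _]; last by rewrite (eqP (FX i)) eqxx.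
  by rewrite prodr_const card_ord mulVf // expf_neq0.
rewrite negb_forall => /existsP[i /negPf FXi].
by rewrite (bigD1 i) //= FXi mul0r mulr0.
Qed.

(** Total extension of [U]; it is only used at pairs i <= j, where [insub]
    succeeds. *)
Definition upper_value (U : {ffun upper_index n -> A}) (i j : 'I_n) : A :=
  if (insub (i, j) : option (upper_index n)) is Some ij then U ij else 0.

(** The [Cm]-symmetric matrix with upper triangle [U]. *)
Definition from_upper (U : {ffun upper_index n -> A}) : 'M[A]_n :=
  \matrix_(i, j) if (i <= j)%N then upper_value U i j else upper_value U j i + Cm i j.

Lemma from_upperE U (ij : upper_index n) :
  from_upper U (val ij).1 (val ij).2 = U ij.
Proof.
by rewrite mxE (valP ij) /upper_value -surjective_pairing valK.
Qed.

Lemma from_upper_symmetric U : alternating_mx Cm -> symmetric_for Cm (from_upper U).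
Proof.
move=> [CT C0]; apply/matrixP => i j; rewrite !mxE.
have Cji : Cm j i = - Cm i j by have := congr1 (fun M : 'M[A]_n => M i j) CT; rewrite !mxE.
case: (ltngtP i j) => [_|_|/val_inj ->]; last by rewrite subrr C0.
  by rewrite opprD addrA subrr add0r Cji opprK.
by rewrite addrC addKr.
Qed.

Lemma from_upperK X : symmetric_for Cm X ->
  from_upper [ffun ij : upper_index n => X (val ij).1 (val ij).2] = X.
Proof.
move=> symX; have XE i j : X i j = X j i + Cm i j.
  by rewrite -symX !mxE addrCA subrr addr0.
apply/matrixP => i j; rewrite mxE /upper_value.
case: ifP => ij; first by rewrite insubT ffunE.
have ji : (j <= i)%N by case: (leqP j i) => // /ltnW; rewrite ij.
by rewrite insubT ffunE [RHS]XE.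
Qed.

Section Moment.
Hypothesis C_alt : alternating_mx Cm.
Variables (eps : R) (p : upper_index n -> A -> R) (theta : R).
Hypothesis p_law : forall ij, balanced_law eps (p ij).
Hypothesis theta01 : 0 <= theta < 1.
Hypothesis theta_bound : forall ij c, c != 0 -> `|char_fun z (p ij) c| <= theta%:C%C.

(** The expected number of surjections onto [G] from the cokernel of the
    [Cm]-symmetric matrix whose upper entries are independent with laws [p]. *)
Definition moment : R :=
  \sum_(U : {ffun upper_index n -> A}) (\prod_ij p ij (U ij)) *
    #|[set F : {ffun 'I_n -> G} | generating F && annihilates F (from_upper U)]|%:R.

(** By independence the expectation of the exponential of a linear form in the
    upper entries is a product of characteristic functions. *)
Lemma moment_fourier : moment%:C%C =
  #|G|%:R ^- n * \sum_(h : {ffun 'I_n -> H} | generating (tuple_fst h))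
     e (- twist h) * \prod_ij char_fun z (p ij) (hcoef h ij).
Proof.
rewrite /moment rmorph_sum.
have termE (U : {ffun upper_index n -> A}) : ((\prod_ij p ij (U ij)) *
    #|[set F : {ffun 'I_n -> G} | generating F && annihilates F (from_upper U)]|%:R)%:C%C =
  \sum_(h : {ffun 'I_n -> H} | generating (tuple_fst h)) #|G|%:R ^- n *
    (e (- twist h) * \prod_ij ((p ij (U ij))%:C%C * e (hcoef h ij * U ij))).
  rewrite rmorphM rmorph_nat count_fourier -!mulr_sumr mulrCA; congr (_ * _).
  rewrite mulr_sumr; apply: eq_bigr => h _.
  rewrite (symmetric_pairing h (from_upper_symmetric U C_alt)) addrC root_charD //.
  rewrite mulrCA; congr (_ * _); rewrite big_split /= rmorph_prod; congr (_ * _).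
  rewrite root_char_sum //; apply: eq_bigr => ij _.
  by rewrite from_upperE.
rewrite (eq_bigr _ (fun U _ => termE U)) exchange_big /= mulr_sumr.
apply: eq_bigr => h _; rewrite -!mulr_sumr; congr (_ * (_ * _)).
by rewrite -(bigA_distr_bigA (fun ij x => (p ij x)%:C%C * e (hcoef h ij * x))).
Qed.

Lemma norm_prod_char_fun h :
  `|\prod_ij char_fun z (p ij) (hcoef h ij)| <=
    (theta ^+ ncoef (@hyp_b a G) (@hyp_q a G) h)%:C%C.
Proof.
have /andP[theta0 theta1] := theta01.
rewrite normr_prod /ncoef -prodr_const rmorph_prod /= big_mkcond /=.
rewrite [X in _ <= X]big_mkcond /=; apply: ler_prod => ij _.
rewrite normr_ge0 inE; case: (eqVneq (hcoef h ij) 0) => [->|]; last exact: theta_bound.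
have [p0 p1 _] := p_law ij.
rewrite /char_fun (eq_bigr (fun x => (p ij x)%:C%C)) => [|x _]; last first.
  by rewrite mul0r root_char0 mulr1.
by rewrite -rmorph_sum p1 rmorph1 normr1 /= lexx.
Qed.

Lemma special_prod_char_fun h : special_tuple h ->
  \prod_ij char_fun z (p ij) (hcoef h ij) = 1.
Proof.
move=> /eqP/eqP; rewrite /ncoef cards_eq0 => /eqP h0; apply: big1 => ij _.
have /negbFE/eqP -> : (hcoef h ij != 0) = false.
  by have := finset.in_set0 ij; rewrite -h0 inE.
have [p0 p1 _] := p_law ij.
rewrite /char_fun (eq_bigr (fun x => (p ij x)%:C%C)) => [|x _]; last first.
  by rewrite mul0r root_char0 mulr1.
by rewrite -rmorph_sum p1 rmorph1.
Qed.

(** Special tuples contribute e(- twist) exactly, and they are the graphs of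
    alternating forms; the others contribute at most [theta] to the number of
    their nonzero coefficients. *)
Lemma moment_special :
  `|moment%:C%C - #|G|%:R ^- n * \sum_(F | generating F)
     \sum_(B in alternating_forms a G) e (- twist (graph_tuple F B))| <=
  (nonspecial_sum (@hyp_b a G) (@hyp_q a G) theta n / #|G|%:R ^+ n)%:C%C.
Proof.
rewrite moment_fourier -mulrBr -(sum_special G_exp (fun h => e (- twist h))).
rewrite (bigID (@special_tuple a G n)) /=.
rewrite [X in X + _ - _](eq_bigr (fun h => e (- twist h))) => [|h /andP[_ sp_h]]; last first.
  by rewrite special_prod_char_fun // mulr1.
rewrite addrAC subrr add0r normrM normfV normrX normr_nat mulrC.
rewrite rmorphM fmorphV rmorphXn rmorph_nat ler_wpM2r ?invr_ge0 ?exprn_ge0 ?ler0n //.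
apply: le_trans (ler_norm_sum _ _ _) _; rewrite rmorph_sum /=.
rewrite big_mkcond [X in _ <= X]big_mkcond /=; apply: ler_sum => h _.
have /andP[theta0 _] := theta01.
rewrite /special_tuple; case: eqP => _; rewrite ?andbF //= andbT.
case: ifP => _; last by rewrite ler0c exprn_ge0.
by rewrite normrM norm_root_char // mul1r norm_prod_char_fun.
Qed.

End Moment.

(** A tuple that does not generate [G] has all its entries in a proper subset,
    namely the image of its [lincomb]. *)
Lemma card_nongenerating :
  (#|[set F : {ffun 'I_n -> G} | ~~ generating F]| <= 2 ^ #|G| * (#|G| - 1) ^ n)%N.
Proof.
apply: (@leq_trans (\sum_(L : {set G} | L != [set: G]) #|L| ^ n)%N).
  apply: (@leq_trans (\sum_(F : {ffun 'I_n -> G}) \sum_(L : {set G} | L != [set: G])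
      (F \in ffun_on (mem L)))%N).
    rewrite -sum1dep_card big_mkcond /=; apply: leq_sum => F _.
    case: ifP => // /forallPn[y nFy].
    pose L := [set lincomb F v | v in [set: 'cV[A]_n]].
    have LT : L != [set: G].
      apply: contra nFy => /eqP LT; have : y \in L by rewrite LT finset.in_setT.
      by case/imsetP => v _ ->; apply/existsP; exists v.
    rewrite (bigD1 L) //= [F \in _](_ : _ = true) //.
    apply/ffun_onP => i; apply/imsetP; exists (delta_mx i 0); first exact: finset.in_setT.
    by rewrite lincomb_delta.
  rewrite exchange_big /=; apply: leq_sum => L _.
  have cardL := card_ffun_on 'I_n (mem L); rewrite card_ord in cardL.
  rewrite -cardL -sum1_card [X in (_ <= X)%N]big_mkcond.
  by apply: leq_sum => F _; case: ifP.
apply: (@leq_trans (\sum_(L : {set G} | L != [set: G]) (#|G| - 1) ^ n)%N).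
  apply: leq_sum => L LT; have [->|n_gt0] := posnP n; first by rewrite !expn0.
  have ltL : (#|L| < #|G|)%N by rewrite -cardsT proper_card // finset.properT.
  by rewrite leq_exp2r // subn1 -ltnS (ltn_predK ltL).
rewrite sum_nat_const leq_mul2r; apply/orP; right.
rewrite -cardsT -card_powerset; apply/subset_leq_card/fintype.subsetP => L _.
by rewrite powersetE finset.subsetT.
Qed.

End Fourier.

(** * From random matrices to their laws *)

Section FiniteLaw.
Context d (T : measurableType d) (R : realType) (P : probability T R).
Local Open Scope classical_set_scope.
Local Open Scope ereal_scope.
Variables (A : finType) (N : T -> A).
Hypothesis N_rand : random_element N.

Lemma integral_random_element (f : A -> R) : (forall x, (0 <= f x)%R) ->
  \int[P]_w (f (N w))%:E = \sum_x (f x)%:E * P (N @^-1` [set x]).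
Proof.
move=> f0.
have fE w : (f (N w))%:E = \sum_x (f x)%:E * (\1_(N @^-1` [set x]) w)%:E.
  rewrite (bigD1 (N w)) //= indicE mem_set // mule1 big1 ?adde0 // => x xN.
  by rewrite indicE memNset ?mule0 //= => /esym/eqP; rewrite (negPf xN).
under eq_integral do rewrite fE.
rewrite ge0_integral_sum //.
- apply: eq_bigr => x _; rewrite ge0_integralZl_EFin //.
  + by rewrite integral_indic // setIT.
  + exact/measurable_EFinP/measurable_indic/N_rand.
- move=> x; apply: emeasurable_funM => //.
  exact/measurable_EFinP/measurable_indic/N_rand.
- by move=> x w _; rewrite mule_ge0 // lee_fin.
Qed.

Lemma measurable_random_element (Q : pred A) : measurable [set w | Q (N w)].
Proof.
have -> : [set w | Q (N w)] = \bigcup_(x in [set` Q]) N @^-1` [set x].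
  by apply/seteqP; split=> [w Qw|w [x Qx Nwx]]; [by exists (N w) | move: Nwx => /= ->].
by apply: fin_bigcup_measurable => // x _; exact: N_rand.
Qed.

Lemma random_element_comp (B : finType) (phi : A -> B) : random_element (phi \o N).
Proof.
move=> y; rewrite (_ : _ @^-1` _ = [set w | phi (N w) == y]).
  exact: (measurable_random_element (fun x => phi x == y)).
by apply/seteqP; split=> w /eqP.
Qed.

Definition law (x : A) : R := fine (P (N @^-1` [set x])).

Lemma lawE x : P (N @^-1` [set x]) = (law x)%:E.
Proof. by rewrite fineK // fin_num_measure //; exact: N_rand. Qed.

Lemma law_ge0 x : (0 <= law x)%R.
Proof. by rewrite fine_ge0. Qed.

Lemma law_event (Q : pred A) : P [set w | Q (N w)] = (\sum_(x | Q x) law x)%:E.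
Proof.
have mQ := measurable_random_element Q.
have -> : P [set w | Q (N w)] = \int[P]_w ((Q (N w))%:R : R)%:E.
  rewrite -(setIT [set w | Q (N w)]) -integral_indic //; apply: eq_integral => w _.
  rewrite indicE; congr ((nat_of_bool _)%:R%:E).
  by apply/idP/idP => [/set_mem|/mem_set].
rewrite (@integral_random_element (fun x => (Q x)%:R)%R) => [|x]; last exact: ler0n.
rewrite -sumEFin [RHS]big_mkcond; apply: eq_bigr => x _.
by rewrite lawE; case: (Q x); rewrite ?mul1e ?mul0e.
Qed.

Lemma law_sum1 : (\sum_x law x = 1)%R.
Proof.
apply: EFin_inj; rewrite -(law_event predT) -(probability_setT P).
by congr (P _); apply/seteqP.
Qed.

End FiniteLaw.

Section MaximalIdeals.
Local Open Scope classical_set_scope.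

(** The annihilator of c <> 0 does not contain 1, and among the finitely many
    proper ideals containing it one of largest cardinality is maximal. *)
Lemma annihilator_sub_maximal (A : finComPzRingType) (c : A) : c != 0 ->
  exists2 p : set A, maximal_ideal p & forall y, c * y = 0 -> p y.
Proof.
move=> c0.
pose Q (S : {set A}) : bool := `[< [/\ is_ideal [set` S],
  [set` S] <> setT & forall y, c * y = 0 -> y \in S] >].
pose S0 : {set A} := finset.finset (fun y => c * y == 0).
have QS0 : Q S0.
  apply/asboolP; split.
  - split=> [|x y|r x] /=; rewrite !finset.in_set ?mulr0 //.
      by rewrite mulrDr => /eqP -> /eqP ->; rewrite addr0.
    by rewrite mulrCA => /eqP ->; rewrite mulr0.
  - move=> S0T; have : [set` S0] 1 by rewrite S0T.
    by rewrite /= finset.in_set mulr1 (negPf c0).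
  - by move=> y cy; rewrite finset.in_set cy.
case: (arg_maxnP (fun S : {set A} => #|S|) QS0) => S /asboolP[S_ideal ST S_ann] maxS.
exists [set` S] => //; split=> // J J_ideal SJ.
have [->|JT] := pselect (J = setT); first by right.
left; pose S' : {set A} := finset.finset (fun x => `[< J x >]).
have S'J : [set` S'] = J.
  by apply/seteqP; split=> x /=; rewrite finset.in_set => /asboolP.
have SS' : S \subset S'.
  by apply/fintype.subsetP => x Sx; rewrite finset.in_set; apply/asboolP/SJ.
have QS' : Q S'.
  apply/asboolP; split; rewrite ?S'J // => y cy.
  by apply: (fintype.subsetP SS'); exact: S_ann.
suff -> : S = S' by [].
have leS : (#|S'| <= #|S|)%N := maxS S' QS'.
by apply/eqP; rewrite eqEcard SS' leS.
Qed.

End MaximalIdeals.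

Section MomentExpectation.
Context d (T : measurableType d) (R : realType) (P : probability T R).
Variables (a : nat) (G : finZmodType).
Local Notation A := (Zmod a).
Hypothesis G_exp : forall x : G, x *+ a.-1.+1 = 0.
Variables (n : nat) (eps : R) (Cm : 'M[A]_n) (X : T -> 'M[A]_n).
Hypothesis X_rand : random_balanced_symmetric_for P eps Cm X.
Local Open Scope classical_set_scope.

Let entry_rand ij : random_element (upper_entry X ij).
Proof.
case: X_rand => mX _ _ _.
have := random_element_comp mX (fun M : 'M[A]_n => M (val ij).1 (val ij).2 : A).
by [].
Qed.

Definition entry_law (ij : upper_index n) : A -> R := law P (upper_entry X ij).

Lemma entry_law_balanced ij : balanced_law eps (entry_law ij).
Proof.
split=> [x||c x c0]; [exact: law_ge0 | exact: (law_sum1 P (entry_rand ij)) |].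
have [p p_max p_ann] := annihilator_sub_maximal c0.
case: X_rand => _ _ _ /(_ ij p p_max x) bal.
rewrite -lee_fin -(law_event P (entry_rand ij) (fun y => c * (y - x) == 0)).
apply: le_trans bal; apply: le_measure; rewrite ?inE.
- exact: (measurable_random_element (entry_rand ij) (fun y => c * (y - x) == 0)).
- rewrite (_ : [set w | _] = [set w | `[< p (upper_entry X ij w - x) >]]).
    exact: (measurable_random_element (entry_rand ij) (fun y => `[< p (y - x) >])).
  by apply/seteqP; split=> w /asboolP.
- by move=> w /= /eqP /p_ann.
Qed.

(** A [Cm]-symmetric matrix is determined by its upper triangle, so the event
    X = [from_upper] U is an intersection of independent events. *)
Lemma upper_law (U : {ffun upper_index n -> A}) :
  P (X @^-1` [set from_upper Cm U]) = (\prod_ij entry_law ij (U ij))%:E.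
Proof.
case: X_rand => _ symX indep _.
rewrite -prodEFin (eq_bigr (fun ij => P (upper_entry X ij @^-1` [set U ij])))
  => [|ij _]; last by rewrite (lawE P (entry_rand ij)).
have := indep [set: upper_index n]%SET (fun ij => [set U ij]).
rewrite -(eq_bigl _ _ (@finset.in_setT (upper_index n))) => <-.
congr (P _); apply/seteqP; split=> w /=.
  by move=> XU ij _; rewrite /= /upper_entry XU from_upperE.
move=> XU; rewrite -(from_upperK (symX w)); congr from_upper.
by apply/ffunP => ij; rewrite ffunE; apply: XU; rewrite /= finset.in_setT.
Qed.

Lemma expectation_moment :
  ('E_P[fun w => #|Sur (coker (X w)) G|%:R] = (moment G Cm entry_law)%:E)%E.
Proof.
have [mX symX _ _] := X_rand.
rewrite expectation.unlock.
rewrite (integral_random_element P mX (f := fun M => #|Sur (coker M) G|%:R)) //.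
pose F (M : 'M[A]_n) := ((#|Sur (coker M) G|%:R)%:E * P (X @^-1` [set M]))%E.
have from_inj : injective (@from_upper a n Cm).
  by move=> U U' eqU; apply/ffunP => ij; rewrite -!(from_upperE Cm) eqU.
rewrite -/(\sum_M F M)%E.
rewrite (bigID (mem [set from_upper Cm U | U in {: {ffun upper_index n -> A}}]%SET)) /=.
rewrite [X in (_ + X)%E]big1 ?adde0 => [|M M_out]; last first.
  rewrite /F (_ : _ @^-1` _ = set0) ?measure0 ?mule0 //.
  apply/seteqP; split=> // w /= XM; move/negP: M_out; apply.
  by apply/imsetP; exists [ffun ij => M (val ij).1 (val ij).2]; rewrite // from_upperK // -XM.
rewrite big_imset => [|U U' _ _ /from_inj //] /=.
rewrite /moment -sumEFin; apply: eq_big => [U|U _]; first by rewrite inE.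
by rewrite /F upper_law card_Sur // -EFinM mulrC.
Qed.

End MomentExpectation.

(** * The exterior square and alternating forms *)

Section WedgeFinite.
Variable G : finZmodType.
Local Notation W := (wedge2 G).

Definition wedge2_enum : seq W := fset_set [set: W]%classic.

Lemma mem_wedge2_enum w : w \in wedge2_enum.
Proof. by rewrite in_fset_set ?inE //; exact: wedge2_finite. Qed.

Definition wedge2_unpickle (k : nat) : option W := nth None (map some wedge2_enum) k.

Lemma wedge2_pickleK : pcancel (fun w => index w wedge2_enum) wedge2_unpickle.
Proof.
move=> w; rewrite /wedge2_unpickle (nth_map w) ?nth_index ?index_mem //;
  exact: mem_wedge2_enum.
Qed.

HB.instance Definition _ := isCountable.Build W wedge2_pickleK.

Lemma wedge2_enumP : Finite.axiom wedge2_enum.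
Proof.
by move=> w; rewrite count_uniq_mem ?fset_uniq // mem_wedge2_enum.
Qed.

HB.instance Definition _ := fintype.isFinite.Build W wedge2_enumP.

Lemma card_wedge2 : #|{: W}| = #|` fset_set [set: W]%classic|.
Proof.
rewrite -(card_uniqP (fset_uniq (fset_set [set: W]%classic))).
by apply: eq_card => w; rewrite inE (mem_wedge2_enum w).
Qed.

End WedgeFinite.

Section WedgeDual.
Variables (a : nat) (G : finZmodType).
Local Notation A := (Zmod a).
Local Notation W := (wedge2 G).
Local Notation free := {ffun G * G -> int}.
Hypothesis G_exp : forall x : G, x *+ a.-1.+1 = 0.

Definition wedge_class (v : free) : W := (\pi_W v)%qT.
Definition wedge (x y : G) : W := wedge_class (wedge_gen x y).

Lemma wedge_classD : {morph wedge_class : u v / u + v}.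
Proof. exact: Quotient.pi_add. Qed.

Lemma wedge_class_eq0 v :
  (wedge_class v == 0) = (v \in gen_subgroup (@wedge_relations G)).
Proof.
have -> : (0 : W) = wedge_class 0.
  by apply: (addrI (wedge_class 0)); rewrite -wedge_classD !addr0.
by rewrite -[v in RHS]subr0 Quotient.idealrBE.
Qed.

Lemma wedge_relation v : wedge_relations v -> wedge_class v = 0.
Proof.
move=> rel_v; apply/eqP; rewrite wedge_class_eq0; apply/asboolP => L [_].
exact.
Qed.

HB.instance Definition _ := GRing.isNmodMorphism.Build free W wedge_class
  (conj (addrI (wedge_class 0) (etrans (esym (wedge_classD 0 0))
     (etrans (congr1 wedge_class (addr0 0)) (esym (addr0 _))))) wedge_classD).

Lemma wedge_classB u v : wedge_class (u - v) = wedge_class u - wedge_class v.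
Proof. exact: raddfB. Qed.

Lemma wedgeDl z : {morph wedge^~ z : x y / x + y}.
Proof.
move=> x y; apply/eqP; rewrite -subr_eq0 opprD addrA; apply/eqP.
by rewrite /wedge -!wedge_classB wedge_relation //; left; left; exists x, y, z.
Qed.

Lemma wedgeDr x : {morph wedge x : y z / y + z}.
Proof.
move=> y z; apply/eqP; rewrite -subr_eq0 opprD addrA; apply/eqP.
by rewrite /wedge -!wedge_classB wedge_relation //; left; right; exists x, y, z.
Qed.

Lemma wedgexx x : wedge x x = 0.
Proof. by rewrite /wedge wedge_relation //; right; exists x. Qed.

Lemma free_sum (v : free) : v = \sum_w wedge_gen w.1 w.2 *~ v w.
Proof.
apply/ffunP => u; rewrite sum_ffunE (bigD1 u) //= big1 => [|w wu].
  by rewrite addr0 ffunMzE ffunE -surjective_pairing eqxx intz.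
by rewrite ffunMzE ffunE -surjective_pairing eq_sym (negPf wu) mul0rz.
Qed.

Lemma wedge_class_sum v : wedge_class v = \sum_w wedge w.1 w.2 *~ v w.
Proof.
by rewrite {1}[v]free_sum raddf_sum; apply: eq_bigr => w _; rewrite raddfMz.
Qed.

Lemma wedge2_exp (w : W) : w *+ a.-1.+1 = 0.
Proof.
have wedge0 y : wedge 0 y = 0.
  by apply: (addrI (wedge 0 y)); rewrite -wedgeDl !addr0.
have wedgeMn x y k : wedge (x *+ k) y = wedge x y *+ k.
  by elim: k => [|k IHk]; rewrite ?mulr0n // !mulrS wedgeDl IHk.
rewrite -[w]generic_quotient.reprK -/(wedge_class _) wedge_class_sum.
rewrite -sumrMnl big1 // => u _.
by rewrite pmulrn mulrzAC -pmulrn -wedgeMn G_exp wedge0 mul0rz.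
Qed.

(** The universal property of the exterior square: homomorphisms to Z/aZ
    are alternating forms. *)
Definition form_of (phi : dual a W) : {ffun G -> dual a G} :=
  [ffun x => mkdual (fun y z => etrans (congr1 phi (wedgeDr x y z)) (dualD phi _ _))].

Lemma form_ofE phi x y : form_of phi x y = phi (wedge x y).
Proof. by rewrite ffunE mkdualE. Qed.

Lemma form_of_alternating phi : form_of phi \in alternating_forms a G.
Proof.
apply/alternating_formsP; split=> [x y|x].
  by apply: dualP => z; rewrite add_dualE !form_ofE wedgeDl dualD.
by rewrite form_ofE wedgexx raddf0.
Qed.

Lemma form_of_inj : injective form_of.
Proof.
move=> phi phi' eq_form; apply: dualP => w.
rewrite -[w]generic_quotient.reprK -/(wedge_class _) wedge_class_sum !raddf_sum.
by apply: eq_bigr => u _; rewrite !raddfMz /= -!form_ofE eq_form.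
Qed.

(** Extend [B] linearly to the free group; the kernel of the extension is a
    subgroup containing the defining relations, so it factors through the
    quotient. *)
Lemma form_of_surj (B : {ffun G -> dual a G}) :
  B \in alternating_forms a G -> exists phi, form_of phi = B.
Proof.
case/alternating_formsP => B_D B0.
pose phi0 (v : free) : A := \sum_w B w.1 w.2 *~ v w.
have phi0B u v : phi0 (u - v) = phi0 u - phi0 v.
  by rewrite /phi0 -sumrB; apply: eq_bigr => w _; rewrite !ffunE mulrzBr.
have phi0_gen x y : phi0 (wedge_gen x y) = B x y.
  rewrite /phi0 (bigD1 (x, y)) //= big1 => [|w wxy].
    by rewrite ffunE eqxx addr0.
  by rewrite ffunE (negPf wxy).
have phi0_K v : v \in gen_subgroup (@wedge_relations G) -> phi0 v = 0.
  move=> /asboolP Kv; apply: (Kv (fun v => phi0 v = 0)); split.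
    split; first by rewrite -[X in phi0 X](subrr 0) phi0B subrr.
    by move=> u' v' u0 v0; rewrite phi0B u0 v0 subrr.
  move=> _ [[[x [y [z ->]]]|[x [y [z ->]]]]|[x ->]].
  - by rewrite !phi0B !phi0_gen B_D add_dualE addrAC addrK subrr.
  - by rewrite !phi0B !phi0_gen dualD addrAC addrK subrr.
  - by rewrite phi0_gen B0.
pose phi1 (w : W) : A := phi0 (generic_quotient.repr w).
have phi1_class v : phi1 (wedge_class v) = phi0 v.
  apply/eqP; rewrite -subr_eq0 -phi0B; apply/eqP/phi0_K.
  by rewrite -wedge_class_eq0 wedge_classB {1}/wedge_class generic_quotient.reprK subrr.
have phi1D : {morph phi1 : u v / u + v}.
  move=> u v; rewrite -[u]generic_quotient.reprK -[v]generic_quotient.reprK.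
  rewrite -!/(wedge_class _) -wedge_classD !phi1_class.
  by apply/eqP; rewrite -subr_eq -phi0B addrK.
exists (mkdual phi1D); apply/ffunP => x; apply: dualP => y.
by rewrite form_ofE mkdualE phi1_class phi0_gen.
Qed.

(** The exterior square is killed by [a], hence has as many homomorphisms to
    Z/aZ as elements. *)
Lemma card_alternating_forms :
  #|alternating_forms a G| = #|` fset_set [set: wedge2 G]%classic|.
Proof.
rewrite -card_wedge2 -(card_dual wedge2_exp) -cardsT -(card_imset _ form_of_inj).
apply: eq_card => B; apply/idP/imsetP => [/form_of_surj[phi <-]|[phi _ ->]].
  by exists phi; rewrite ?finset.in_setT.
exact: form_of_alternating.
Qed.

End WedgeDual.

(** * The main term *)

Section MainTerm.
Variables (a : nat) (R : realType) (z : R[i]).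
Local Notation A := (Zmod a).
Local Notation e := (root_char z).
Hypothesis z_prim : (a.-1.+1).-primitive_root z.
Variable G : finZmodType.
Hypothesis G_exp : forall x : G, x *+ a.-1.+1 = 0.

(** The contribution of the alternating forms, summed over all tuples [F], the
    generating ones and the others. *)
Definition main_term (n : nat) (Cm : 'M[A]_n) : R[i] :=
  #|G|%:R ^- n * \sum_(B in alternating_forms a G)
    \sum_(F : {ffun 'I_n -> G}) e (- twist Cm (graph_tuple F B)).

Definition moment_error (theta : R) (n : nat) : R :=
  nonspecial_sum (@hyp_b a G) (@hyp_q a G) theta n / #|G|%:R ^+ n +
  #|alternating_forms a G|%:R *
    ((2 ^ #|G| * (#|G| - 1) ^ n)%:R / #|G|%:R ^+ n).

Let G_gt0 : (0 < #|G|)%N.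
Proof. by apply/card_gt0P; exists 0. Qed.

(** The moments depend on [Cm] only through [main_term], up to an error that is
    uniform in [Cm] and in the laws. *)
Lemma moment_estimate n (Cm : 'M[A]_n) eps p (theta : R) :
    alternating_mx Cm -> (forall ij, balanced_law eps (p ij)) -> 0 <= theta < 1 ->
    (forall ij c, c != 0 -> `|char_fun z (p ij) c| <= theta%:C%C) ->
  `|(moment G Cm p)%:C%C - main_term Cm| <= (moment_error theta n)%:C%C.
Proof.
move=> C_alt p_law theta01 p_bound.
have le1 := moment_special z_prim G_exp C_alt p_law theta01 p_bound.
set M := (moment G Cm p)%:C%C in le1 *; set S1 := #|G|%:R ^- n * _ in le1.
have -> : M - main_term Cm = (M - S1) + (S1 - main_term Cm) by rewrite addrA subrK.
apply: le_trans (ler_normD _ _) _; rewrite /moment_error rmorphD lerD //.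
have -> : S1 - main_term Cm = - (#|G|%:R ^- n *
    \sum_(F : {ffun 'I_n -> G} | ~~ generating a F)
      \sum_(B in alternating_forms a G) e (- twist Cm (graph_tuple F B))).
  rewrite /main_term exchange_big (bigID (fun F => generating a F)) /=.
  by rewrite mulrDr opprD addrA subrr add0r.
rewrite normrN normrM normfV normrX normr_nat mulrC.
have := card_nongenerating G_exp n.
move: (2 ^ #|G| * (#|G| - 1) ^ n)%N => Q card_Q.
rewrite !rmorphM fmorphV rmorphXn !rmorph_nat mulrA.
rewrite ler_wpM2r ?invr_ge0 ?exprn_ge0 ?ler0n //.
apply: le_trans (ler_norm_sum _ _ _) _.
apply: le_trans (_ : \sum_(F : {ffun 'I_n -> G} | ~~ generating a F)
   #|alternating_forms a G|%:R <= _).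
  apply: ler_sum => F _; apply: le_trans (ler_norm_sum _ _ _) _.
  rewrite (eq_bigr (fun=> 1)) ?sumr_const // => B _.
  exact: norm_root_char.
rewrite (eq_bigl (fun F => F \in [set F : {ffun 'I_n -> G} | ~~ generating a F])) => [|F];
  last by rewrite inE.
by rewrite sumr_const -[_ *+ #|_|]mulr_natr ler_wpM2l ?ler0n // ler_nat.
Qed.

Lemma moment_error_cvg (theta : R) : 0 <= theta < 1 ->
  (moment_error theta n @[n --> \oo] --> (0 : R))%classic.
Proof.
move=> /andP[theta0 theta1].
have G0 : 0 < #|G|%:R :> R by rewrite ltr0n.
rewrite -[X in (_ --> X)%classic](addr0 0); apply: cvgD.
  apply: nonspecial_sum_cvg => //; [exact: hyp_bC | exact: hyp_bD | | exact: hyp_qD |].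
  - exact: hyp_nondeg.
  - exact: card_doubled.
rewrite -[X in (_ --> X)%classic](mulr0 #|alternating_forms a G|%:R).
apply: cvgM; first exact: cvg_cst.
apply: (@geometric_squeeze _ _ (2 ^ #|G|)%:R ((#|G| - 1)%:R / #|G|%:R) 0).
- by rewrite divr_ge0 ?ler0n.
- by rewrite ltr_pdivrMr // mul1r ltr_nat subn1 prednK.
- move=> n _; rewrite divr_ge0 ?ler0n ?exprn_ge0 //=.
  by rewrite natrM !natrX expr_div_n mulrA.
Qed.

Lemma main_term0 n : main_term (0 : 'M[A]_n) = #|alternating_forms a G|%:R.
Proof.
have twist0 h : twist (0 : 'M[A]_n) h = 0 :> A.
  by rewrite /twist big1 // => i _; rewrite big1 // => j _; rewrite mxE mulr0.
rewrite /main_term (eq_bigr (fun=> #|G|%:R ^+ n)) => [|B _].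
  rewrite sumr_const -[_ *+ #|_|]mulr_natr mulrA mulVf ?mul1r //.
  by rewrite expf_neq0 // pnatr_eq0 -lt0n.
rewrite (eq_bigr (fun=> 1)) => [|F _]; last by rewrite twist0 oppr0 root_char0.
by rewrite sumr_const card_ffun card_ord natrX.
Qed.

End MainTerm.

Section Determinant.
Variables (a : nat) (R : realType) (z : R[i]).
Local Notation A := (Zmod a).
Local Notation e := (root_char z).
Hypothesis z_prim : (a.-1.+1).-primitive_root z.
Local Notation G := (A * A)%type.

Lemma plane_exp (x : G) : x *+ a.-1.+1 = 0.
Proof. by rewrite pair_mulrn !Zmod_exp. Qed.

Lemma det_additive (x : G) :
  {morph (fun y : G => x.1 * y.2 - y.1 * x.2) : y y' / y + y'}.
Proof. by move=> y y' /=; rewrite mulrDr mulrDl opprD addrACA. Qed.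

(** The determinant form ((x1, x2), (y1, y2)) |-> x1 y2 - y1 x2. *)
Definition det_form : {ffun G -> dual a G} := [ffun x => mkdual (det_additive x)].

Lemma det_formE x y : det_form x y = x.1 * y.2 - y.1 * x.2.
Proof. by rewrite ffunE mkdualE. Qed.

Lemma det_form_alternating : det_form \in alternating_forms a G.
Proof.
apply/alternating_formsP; split=> [x y|x]; last by rewrite det_formE subrr.
apply: dualP => w; rewrite add_dualE !det_formE /= mulrDl mulrDr opprD.
exact: addrACA.
Qed.

Variables (n : nat) (Cm : 'M[A]_n).
Hypothesis C_alt : alternating_mx Cm.

(** For a tuple F = (x, y) of pairs the twist by the determinant form is the
    bilinear expression x^T C y: the terms x_j y_i C_ij with i <= j become those
    with i >= j by antisymmetry, and the diagonal of [Cm] is zero. *)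
Lemma twist_det (F : {ffun 'I_n -> G}) :
  twist Cm (graph_tuple F det_form) =
  \sum_(i < n) (F i).1 * \sum_(j < n) Cm i j * (F j).2.
Proof.
have [CT C0] := C_alt.
have Cji i j : Cm j i = - Cm i j.
  by have := congr1 (fun M : 'M[A]_n => M i j) CT; rewrite !mxE.
pose f i j := (F i).1 * (F j).2 * Cm i j.
transitivity (\sum_(i < n) \sum_(j < n | (i <= j)%N) (f i j + f j i)).
  rewrite /twist; apply: eq_bigr => i _; apply: eq_bigr => j _.
  by rewrite !graph_tupleE /= det_formE mulrBl /f (Cji i j) mulrN.
transitivity (\sum_(i < n) \sum_(j < n) f i j); last first.
  apply: eq_bigr => i _; rewrite mulr_sumr; apply: eq_bigr => j _.
  by rewrite /f -mulrA [_.2 * _]mulrC.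
under eq_bigr do rewrite big_split /=.
rewrite big_split /= [X in _ + X](exchange_big_dep predT) //= -big_split /=.
apply: eq_bigr => i _; rewrite [RHS](bigID (fun j : 'I_n => (i <= j)%N)) /=.
congr (_ + _); rewrite (bigD1 i) //= /f C0 mulr0 add0r.
apply: eq_bigl => j; rewrite -ltnNge ltn_neqAle andbC.
by rewrite -[(j : nat) != i]/(j != i).
Qed.

Definition mx_kernel : {set {ffun 'I_n -> A}} :=
  [set y : {ffun 'I_n -> A} | [forall i, \sum_j Cm i j * y j == 0]].

(** Summing e(- x^T C y) over x detects C y = 0. *)
Lemma sum_twist_det :
  \sum_(F : {ffun 'I_n -> G}) e (- twist Cm (graph_tuple F det_form)) =
  (#|mx_kernel| * #|{: A}| ^ n)%:R.
Proof.
pose f (x y : {ffun 'I_n -> A}) : A := - \sum_i x i * \sum_j Cm i j * y j.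
have fD y : {morph f^~ y : x x' / x + x'}.
  move=> x x'; rewrite /f -opprD -big_split; congr (- _); apply: eq_bigr => i _.
  by rewrite ffunE mulrDl.
transitivity (\sum_y \sum_x e (f x y)).
  rewrite exchange_big sum_ffun_pair /=; apply: eq_bigr => F _.
  rewrite twist_det /f; congr (e (- _)); apply: eq_bigr => i _.
  by rewrite ffunE; congr (_ * _); apply: eq_bigr => j _; rewrite ffunE.
rewrite (eq_bigr _ (fun y _ => root_char_sumT z_prim (fD y))).
rewrite natrM mulr_natl -[RHS]sumr_const [RHS]big_mkcond /=; apply: eq_bigr => y _.
rewrite inE card_ffun !card_ord; congr (if _ then _ else _).
apply/forallP/forallP => [fy0 i|Cy0 x].
  have := fy0 [ffun k => (k == i)%:R].
  rewrite oppr_eq0 (bigD1 i) //= [X in _ + X]big1 => [|k ki].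
    by rewrite ffunE eqxx mul1r addr0.
  by rewrite ffunE (negPf ki) mul0r.
by rewrite oppr_eq0 big1 // => i _; rewrite (eqP (Cy0 i)) mulr0.
Qed.

(** The kernel is a proper subgroup; a translate of it is disjoint from it. *)
Lemma card_kernel_half : Cm != 0 ->
  (2 * #|mx_kernel| <= #|{: A}| ^ n)%N.
Proof.
move=> Cm0; have [i0 [j0 C_ij]] : exists i0, exists j0, Cm i0 j0 != 0.
  suff /existsP[i /existsP[j]] : [exists i, [exists j, Cm i j != 0]] by exists i, j.
  apply: contraNT Cm0; rewrite negb_exists => /forallP C0.
  apply/eqP/matrixP => i j; rewrite mxE; apply/eqP; have := C0 i.
  by rewrite negb_exists => /forallP/(_ j); rewrite negbK.
pose K := mx_kernel; rewrite -/K; pose y0 : {ffun 'I_n -> A} := [ffun j => (j == j0)%:R].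
have Cy0 : \sum_j Cm i0 j * y0 j = Cm i0 j0.
  rewrite (bigD1 j0) //= big1 => [|j jj0]; rewrite ffunE; last first.
    by rewrite (negPf jj0) mulr0.
  by rewrite eqxx mulr1 addr0.
pose K' := [set y + y0 | y in K].
have K'K : [disjoint K & K'].
  rewrite disjoint_subset; apply/fintype.subsetP => y; rewrite inE => /forallP/(_ i0)/eqP Ky.
  rewrite inE; apply/imsetP => -[y' + yE]; rewrite inE => /forallP/(_ i0)/eqP Ky'.
  suff E : \sum_j Cm i0 j * y j = Cm i0 j0 by move: C_ij; rewrite -E Ky eqxx.
  rewrite -Cy0 -[RHS]add0r -[X in _ = X + _]Ky' -big_split yE; apply: eq_bigr => j _.
  by rewrite ffunE mulrDr.
have card_K' : #|K'| = #|K| by apply: card_imset; exact: addIr.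
have /eqP card_U : #|K :|: K'| == (#|K| + #|K'|)%N by rewrite (leq_card_setU K K').2.
rewrite mul2n -addnn -{2}card_K' -card_U.
by apply: leq_trans (max_card _) _; rewrite card_ffun !card_ord.
Qed.

(** The determinant form contributes at most 1/2, every other form at most 1. *)
Lemma main_term_half : Cm != 0 ->
  `|main_term z G Cm| <= #|alternating_forms a G|%:R - 1 / 2.
Proof.
move=> Cm0.
have G_gt0 : 0 < #|{: G}|%:R ^+ n :> R[i].
  by rewrite exprn_gt0 // ltr0n; apply/card_gt0P; exists 0.
rewrite /main_term normrM normfV normrX normr_nat mulrC ler_pdivrMr //.
apply: le_trans (ler_norm_sum _ _ _) _.
rewrite (bigD1 det_form) ?det_form_alternating //= sum_twist_det normr_nat.
apply: le_trans (_ : 1 / 2 * #|{: G}|%:R ^+ n +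
   \sum_(B in alternating_forms a G | B != det_form) #|{: G}|%:R ^+ n <= _).
  apply: lerD.
    rewrite mul1r ler_pdivlMl ?ltr0n // -natrM -natrX ler_nat card_prod expnMn mulnA.
    by rewrite leq_mul2r; apply/orP; right; exact: card_kernel_half.
  apply: ler_sum => B _; apply: le_trans (ler_norm_sum _ _ _) _.
  rewrite (eq_bigr (fun=> 1)) => [|F _]; last exact: norm_root_char.
  by rewrite sumr_const card_ffun card_ord natrX.
rewrite (cardsD1 det_form) det_form_alternating natrD.
rewrite (eq_bigl (fun B => B \in alternating_forms a G :\ det_form)) => [|B].
  rewrite sumr_const -[_ *+ #|_|]mulr_natl -mulrDl ler_wpM2r ?(ltW G_gt0) //.
  have -> : true%:R = 1 :> R[i] by [].
  by rewrite le_eqVlt; apply/orP; left; apply/eqP; field.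
by rewrite finset.in_setD1 andbC.
Qed.

End Determinant.

(** * Limits *)

Lemma norm_real_complex (R : rcfType) (x : R) : `|x%:C%C| = `|x|%:C%C.
Proof. by rewrite normc_def /= expr0n addr0 sqrtr_sqr. Qed.

Section Limits.
Variables (R : realType) (a : nat) (eps : R).
Hypothesis eps_gt0 : 0 < eps.
Variables (d : nat -> measure_display) (T : forall n, measurableType (d n)).
Variables (P : forall n, probability (T n) R) (C : forall n, 'M[Zmod a]_n).
Hypothesis C_alt : forall n, (0 < n)%N -> alternating_mx (C n).
Variable X : forall n, T n -> 'M[Zmod a]_n.
Hypothesis X_rand : forall n, (0 < n)%N ->
  random_balanced_symmetric_for (P n) eps (C n) (@X n).
Variable z : R[i].
Hypothesis z_prim : (a.-1.+1).-primitive_root z.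
Variable G : finZmodType.
Hypothesis G_exp : forall x : G, x *+ a.-1.+1 = 0.

Local Notation E n := ('E_(P n)[fun w => #|Sur (coker (X w)) G|%:R])%E.
Local Notation mom n := (moment G (C n) (entry_law (P n) (@X n))).

Lemma expectation_near : (\forall n \near \oo, (E n = (mom n)%:E)%E)%classic.
Proof.
exists 1%N => // n n_gt0; exact: (expectation_moment G_exp (X_rand n_gt0)).
Qed.

Lemma moment_near_main : exists2 err : nat -> R,
  (err n @[n --> \oo] --> (0 : R))%classic &
  forall n, (0 < n)%N -> `|(mom n)%:C%C - main_term z G (C n)| <= (err n)%:C%C.
Proof.
have [theta theta01 theta_bound] := char_fun_bound z_prim eps_gt0.
exists (moment_error a G theta); first exact: moment_error_cvg.
move=> n n_gt0; apply: moment_estimate; [by []|by []|exact: C_alt| |exact: theta01|].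
  exact: (entry_law_balanced (X_rand n_gt0)).
move=> ij c; apply: theta_bound; exact: (entry_law_balanced (X_rand n_gt0)).
Qed.

Lemma expectation_cvgP (l : R) :
  (E n @[n --> \oo] --> l%:E)%classic <-> (mom n @[n --> \oo] --> l)%classic.
Proof.
split=> [E_l|mom_l].
- have : ((mom n)%:E @[n --> \oo] --> l%:E)%classic.
    apply: cvg_trans E_l; apply: near_eq_cvg.
    by apply: filterS expectation_near => n ->.
  by move/fine_cvg.
- have mom_l' : ((mom n)%:E @[n --> \oo] --> l%:E)%classic.
    by apply: cvg_EFin => //; apply: nearW.
  apply: cvg_trans mom_l'; apply: near_eq_cvg.
  by apply: filterS expectation_near => n ->.
Qed.

Lemma moment_cvg_of_zero : (\forall n \near \oo, C n = 0)%classic ->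
  (mom n @[n --> \oo] --> (#|alternating_forms a G|%:R : R))%classic.
Proof.
move=> C0; have [err err0 mom_err] := moment_near_main.
apply/cvgrPdist_le => e e0.
have [N1 _ N1P] := C0.
have /cvgrPdist_le/(_ e e0)[N2 _ N2P] := err0.
exists (N1 + N2).+1 => // n /= n_gt.
have := mom_err n (leq_trans (ltn0Sn _) n_gt).
rewrite (N1P n) ?main_term0 //=; last first.
  by apply: leq_trans n_gt; rewrite ltnW // ltnS leq_addr.
rewrite -(rmorph_nat (real_complex R)) -rmorphB norm_real_complex lecR distrC => le_err.
have := N2P n; rewrite sub0r normrN => err_e; apply: le_trans le_err _.
apply: le_trans (ler_norm _) _; apply: err_e; apply: leq_trans n_gt.
by rewrite ltnW // ltnS leq_addl.
Qed.

End Limits.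

Section Converse.
Variables (R : realType) (a : nat) (eps : R).
Hypothesis eps_gt0 : 0 < eps.
Variables (d : nat -> measure_display) (T : forall n, measurableType (d n)).
Variables (P : forall n, probability (T n) R) (C : forall n, 'M[Zmod a]_n).
Hypothesis C_alt : forall n, (0 < n)%N -> alternating_mx (C n).
Variable X : forall n, T n -> 'M[Zmod a]_n.
Hypothesis X_rand : forall n, (0 < n)%N ->
  random_balanced_symmetric_for (P n) eps (C n) (@X n).
Variable z : R[i].
Hypothesis z_prim : (a.-1.+1).-primitive_root z.
Local Notation G := (Zmod a * Zmod a)%type.
Local Notation mom n := (moment G (C n) (entry_law (P n) (@X n))).

(** By [main_term_half], for large n with C_n <> 0 the moment is smaller than
    the number of alternating forms by nearly 1/2 or more. *)
Lemma zero_of_moment_cvg :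
  (mom n @[n --> \oo] --> (#|alternating_forms a G|%:R : R))%classic ->
  (\forall n \near \oo, C n = 0)%classic.
Proof.
move=> mom_alt.
have [err err0 mom_err] :=
  moment_near_main eps_gt0 C_alt X_rand z_prim (@plane_exp a).
have e0 : 0 < 1 / 8 :> R by lra.
move/cvgrPdist_le : mom_alt => /(_ _ e0)[N1 _ N1P].
move/cvgrPdist_le : err0 => /(_ _ e0)[N2 _ N2P].
exists (N1 + N2).+1 => // n /= n_gt.
apply/eqP; apply: contraT => Cn0.
have n_gt0 : (0 < n)%N by apply: leq_trans n_gt.
have := main_term_half z_prim (C_alt n_gt0) Cn0.
have -> : #|alternating_forms a G|%:R - 1 / 2 =
    (#|alternating_forms a G|%:R - 1 / 2 : R)%:C%C :> R[i].
  by rewrite rmorphB rmorph_nat rmorphM fmorphV rmorph1 rmorph_nat.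
have := mom_err n n_gt0.
have le1 : `|#|alternating_forms a G|%:R - mom n| <= 1 / 8.
  by apply: N1P; apply: leq_trans n_gt; rewrite /= ltnW // ltnS leq_addr.
have le2 : `|0 - err n| <= 1 / 8.
  by apply: N2P; apply: leq_trans n_gt; rewrite /= ltnW // ltnS leq_addl.
move=> le3 le4.
have : `|(mom n)%:C%C| <= (err n + (#|alternating_forms a G|%:R - 1 / 2))%:C%C.
  rewrite -[X in `|X|](subrK (main_term z G (C n))) rmorphD.
  exact: le_trans (ler_normD _ _) (lerD le3 le4).
rewrite norm_real_complex lecR => le5.
move: le1 le2 le5; rewrite sub0r normrN !ler_norml => /andP[_ +] /andP[_ +].
have := ler_norm (mom n); move: `|_| => y; move: (mom n) (err n) (_%:R : R) => u v w.
lra.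
Qed.

End Converse.

Local Open Scope classical_set_scope.

Theorem theorem5p3 (a : nat) (a_gt0 : (0 < a)%N) (R : realType) (eps : R)
    (eps_gt0 : 0 < eps)
    (d : nat -> measure_display) (T : forall n, measurableType (d n))
    (P : forall n, probability (T n) R)
    (C : forall n, 'M[Zmod a]_n)
    (C_alt : forall n, (0 < n)%N -> alternating_mx (C n))
    (X : forall n, T n -> 'M[Zmod a]_n)
    (X_rand : forall n, (0 < n)%N ->
      random_balanced_symmetric_for (P n) eps (C n) (X n)) :
  (forall G : finZmodType, (exponent [set: G]%SET %| a)%N ->
     'E_(P n)[fun w => #|Sur (coker (X n w)) G|%:R]%E @[n --> \oo] -->
       (#|` fset_set [set: wedge2 G]|%:R : R)%:E)
  <-> (\forall n \near \oo, C n = 0).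
Proof.
have aE : a.-1.+1 = a by rewrite prednK.
have exp_a (G : finZmodType) : (exponent [set: G]%SET %| a)%N ->
    forall x : G, x *+ a.-1.+1 = 0.
  by rewrite aE => /exponentP expG x; exact: (expG x (finset.in_setT x)).
have [z z_prim] : exists z : R[i], (a.-1.+1).-primitive_root z.
  by apply: closed_field_prim_root; rewrite pnatr_eq0.
split=> [moments|C0 G /exp_a G_exp].
- apply: (zero_of_moment_cvg eps_gt0 C_alt X_rand z_prim).
  apply/(expectation_cvgP X_rand (@plane_exp a)).
  rewrite (card_alternating_forms (@plane_exp a)); apply: moments.
  by rewrite -[X in (_ %| X)%N]aE; apply/exponentP => x _; exact: plane_exp.
- apply/(expectation_cvgP X_rand G_exp); rewrite -(card_alternating_forms G_exp).
  exact: (moment_cvg_of_zero eps_gt0 C_alt X_rand z_prim).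
Qed.
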